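(* Let $\Omega=(a_1,b_1)\times\cdots\times(a_n,b_n)\subset\mathbb{R}^n$, $n\ge2$, be a bounded box with admissible mesh size vector $h$, let $a,b:\Omega_h\to\mathbb{R}$, and let $u\in W_0^{1,2}(\overline{\Omega}_h)$ satisfy $$-\Delta_hu=a(x)u+b(x)\ \text{in }\Omega_h,\qquad u=0\ \text{on }\partial\Omega_h.$$ Let $q>\frac n2$ (for $n=2$ additionally choose $\hat n$ with $q>\frac{\hat n}{2}>1$) and $q'=\frac{q}{q-1}$. Then $$\|u\|_\infty\le(2K)^{q'}\|u\|_{L^2}+2K\|b\|_\infty(1+|\Omega|),$$ where $$K=\max\Big\{\frac{n}{(n-2)q'},\ C_S(n)\sqrt2\,\||a|+1\|_{L^q}^{1/2}\Big\}^{\left(\frac{n(q-1)}{2q-n}\right)^2}\quad\text{if }n\ge3,$$ $$K=\max\Big\{\frac{\hat n}{(\hat n-2)q'},\ \frac{4\hat n}{\hat n-2}C_S(2)(1+C_P(\Omega))\sqrt2\,\||a|+1\|_{L^q}^{1/2}\Big\}^{\left(\frac{\hat n(q-1)}{2q-\hat n}\right)^2}\quad\text{if }n=2.$$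
   Context: Admissible mesh: $h_i>0$, $a_i=k_ih_i$, $b_i=l_ih_i$, $k_i,l_i\in\mathbb{Z}$, $l_i-k_i>1$; $\mathbb{R}^n_h=\{(h_1z_1,\dots,h_nz_n):z_i\in\mathbb{Z}\}$, $\overline{\Omega}_h=\overline{\Omega}\cap\mathbb{R}^n_h$, $\Omega_h=\Omega\cap\mathbb{R}^n_h$, $\partial\Omega_h=\partial\Omega\cap\mathbb{R}^n_h$, $\partial_i^+\Omega_h=\partial\Omega_h\cap\{x_i=b_i\}$, $\mathbf{h}=h_1\cdots h_n$, $|\Omega|=\prod_i(b_i-a_i)$. $\Delta_hu(x)=\sum_i\frac{u(x+h_ie_i)-2u(x)+u(x-h_ie_i)}{h_i^2}$, $D_i^+u(x)=(u(x+h_ie_i)-u(x))/h_i$. Norms: $\|v\|_{L^r}=(\sum_x|v(x)|^r\mathbf{h})^{1/r}$ (sum over the domain of $v$), $\|v\|_\infty=\max|v|$, $\|u\|_D^2=\sum_i\sum_{x\in\overline{\Omega}_h\setminus\partial_i^+\Omega_h}|D_i^+u(x)|^2\mathbf{h}$. $W_0^{1,2}(\overline{\Omega}_h)$ = functions on $\overline{\Omega}_h$ vanishing on $\partial\Omega_h$. Constants: $C_S(n)=\frac{4(n-1)}{\sqrt n(n-2)}$ ($n\ge3$), $C_S(2)=8\sqrt{2\pi(e+256)}$; $C_P(\Omega)$ is a Poincaré constant, i.e. $\|v\|_{L^2}\le C_P(\Omega)\|v\|_D$ for all $v\in W_0^{1,2}(\overline{\Omega}_h)$. *)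

(* Defs.v *)
From mathcomp Require Import all_boot all_order all_algebra.
From mathcomp Require Import all_classical all_reals.
From mathcomp Require Import sequences exp trigo.
Set Implicit Arguments. Unset Strict Implicit. Unset Printing Implicit Defensive.
Import Order.TTheory GRing.Theory Num.Theory.
Local Open Scope ring_scope.

(* Grid points are identified with their integer index z : 'I_n -> int,
   the physical point being x = (h_1 z_1, ..., h_n z_n).
   The box is Omega = prod_i (k_i h_i, l_i h_i). *)
Section Grid.
Variables (R : realType) (n : nat) (h : 'I_n -> R) (k l : 'I_n -> int).

Definition inbar (z : 'I_n -> int) : bool := [forall i, (k i <= z i <= l i)%R].
Definition inint (z : 'I_n -> int) : bool := [forall i, (k i < z i < l i)%R].
Definition onbd (z : 'I_n -> int) : bool := inbar z && ~~ inint z.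
Definition notup (i : 'I_n) (z : 'I_n -> int) : bool := inbar z && (z i != l i).

Definition shift (z : 'I_n -> int) (i : 'I_n) (s : int) : 'I_n -> int :=
  fun j => if j == i then z j + s else z j.

Definition gsize : nat := (\max_(i < n) `|l i - k i|%N).+1.
Definition gpt (p : {ffun 'I_n -> 'I_gsize}) : 'I_n -> int :=
  fun i => k i + (nat_of_ord (p i))%:Z.
Definition gsum (P : ('I_n -> int) -> bool) (F : ('I_n -> int) -> R) : R :=
  \sum_(p : {ffun 'I_n -> 'I_gsize} | inbar (gpt p) && P (gpt p)) F (gpt p).
Definition gmax (P : ('I_n -> int) -> bool) (F : ('I_n -> int) -> R) : R :=
  \big[Num.max/0]_(p : {ffun 'I_n -> 'I_gsize} | inbar (gpt p) && P (gpt p)) F (gpt p).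

Definition hvol : R := \prod_(i < n) h i.
Definition boxvol : R := \prod_(i < n) ((l i - k i)%:~R * h i).

Definition dlap (u : ('I_n -> int) -> R) (z : 'I_n -> int) : R :=
  \sum_(i < n) (u (shift z i 1) - 2 * u z + u (shift z i (-1))) / h i ^+ 2.
Definition Dplus (u : ('I_n -> int) -> R) (i : 'I_n) (z : 'I_n -> int) : R :=
  (u (shift z i 1) - u z) / h i.

Definition Lrnorm (r : R) (P : ('I_n -> int) -> bool) (v : ('I_n -> int) -> R) : R :=
  (gsum P (fun z => `|v z| `^ r * hvol)) `^ r^-1.
Definition supnorm (P : ('I_n -> int) -> bool) (v : ('I_n -> int) -> R) : R :=
  gmax P (fun z => `|v z|).
Definition Dnorm (u : ('I_n -> int) -> R) : R :=
  Num.sqrt (\sum_(i < n) gsum (notup i) (fun z => Dplus u i z ^+ 2 * hvol)).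

Definition W0 (v : ('I_n -> int) -> R) : Prop := forall z, onbd z -> v z = 0.

Definition poincare_const (CP : R) : Prop :=
  forall v, W0 v -> Lrnorm 2 inbar v <= CP * Dnorm v.

End Grid.

Definition CS (R : realType) (n : nat) : R :=
  if (3 <= n)%N then 4 * (n%:R - 1) / (Num.sqrt n%:R * (n%:R - 2))
  else 8 * Num.sqrt (2 * pi * (expR 1 + 256)).

Definition conjexp (R : realType) (q : R) : R := q / (q - 1).

(* the constant K of the theorem; Lq = || |a|+1 ||_{L^q} *)
Definition Kconst (R : realType) (n : nat) (q nhat CP Lq : R) : R :=
  let q' := conjexp q in
  if (3 <= n)%N then
    (Num.max (n%:R / ((n%:R - 2) * q')) (CS R n * Num.sqrt 2 * Lq `^ (2^-1)))
      `^ ((n%:R * (q - 1) / (2 * q - n%:R)) ^+ 2)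
  else
    (Num.max (nhat / ((nhat - 2) * q'))
             (4 * nhat / (nhat - 2) * CS R 2 * (1 + CP) * Num.sqrt 2 * Lq `^ (2^-1)))
      `^ ((nhat * (q - 1) / (2 * q - nhat)) ^+ 2).

(* Main.v *)
(** Moser iteration on the mesh. For [c >= 1], testing the equation with [sg u * |u|^(2c-1)] and
    using a Stroock-Varopoulos inequality bounds the energy of [|u|^c]; the term in [b] is absorbed
    by [B * |u|^(2c-1) <= |u|^(2c) + B^(2c)] with [B] the maximum of [|b|]. Hoelder's inequality
    and a discrete Sobolev inequality turn this into a bound of the [L^(2q'c chi)] norm by the
    [L^(2q'c)] norm, with [chi = n / ((n - 2) q')]. Iterating along [c = chi^m] gives
    [max |u| <= K * max(|u|_(2q'), B (1 + |Omega|))], and interpolating [L^(2q')] between [L^2] and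
    the maximum concludes. The Sobolev inequality comes from the Loomis-Whitney inequality
    through the Gagliardo-Nirenberg argument applied to a power of [|u|]; in dimension 2 it is
    combined with the Poincare inequality. *)
Require Import Defs.
From mathcomp Require Import all_boot all_order all_algebra.
From mathcomp Require Import all_classical all_reals.
From mathcomp Require Import sequences exp trigo.
From mathcomp Require Import ring lra zify.
Set Implicit Arguments. Unset Strict Implicit. Unset Printing Implicit Defensive.
Import Order.TTheory GRing.Theory Num.Theory.
Local Open Scope ring_scope.

(** * Elementary inequalities for real powers *)

Section RealInequalities.
Context {R : realType}.
Implicit Types (x y a b p q r c : R).

Lemma powR_le p x y : 0 <= p -> 0 <= x -> x <= y -> x `^ p <= y `^ p.
Proof.
move=> p0 x0 xy; apply: ge0_ler_powR => //; rewrite nnegrE //.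
exact: le_trans xy.
Qed.

Lemma powRK p x : 0 <= x -> p != 0 -> (x `^ p) `^ p^-1 = x.
Proof. by move=> x0 p0; rewrite -powRrM divff// powRr1. Qed.

Lemma powRVK p x : 0 <= x -> p != 0 -> (x `^ p^-1) `^ p = x.
Proof. by move=> x0 p0; rewrite -powRrM mulVf// powRr1. Qed.

Lemma powRDp x p q : 0 < p + q -> x `^ (p + q) = x `^ p * x `^ q.
Proof. by move=> pq; apply: powRD; rewrite gt_eqF. Qed.

Lemma powR_pow2 p x : 0 <= x -> (x `^ p) ^+ 2 = x `^ (2 * p).
Proof. by move=> x0; rewrite -powR_mulrn ?powR_ge0// -powRrM mulrC. Qed.

Lemma powRV p x : 0 <= x -> (x^-1) `^ p = (x `^ p)^-1.
Proof.
by move=> x0; rewrite -powR_inv1// -powRrM mulrC powRrM powR_inv1 ?powR_ge0.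
Qed.

Lemma powR_prod (I : finType) (P : pred I) (F : I -> R) p :
  (forall i, P i -> 0 <= F i) ->
  (\prod_(i | P i) F i) `^ p = \prod_(i | P i) F i `^ p.
Proof.
move=> F0.
suff [] : 0 <= \prod_(i | P i) F i /\
  (\prod_(i | P i) F i) `^ p = \prod_(i | P i) F i `^ p by [].
apply: (big_ind2 (fun s t : R => 0 <= s /\ s `^ p = t)) => //.
- by rewrite powR1.
- by move=> s1 s2 t1 t2 [s10 <-] [t10 <-]; rewrite mulr_ge0// powRM.
- by move=> i Pi; split=> //; exact: F0.
Qed.

Lemma young s x y : 0 < s -> s < 1 -> 0 <= x -> 0 <= y ->
  x `^ s * y `^ (1 - s) <= s * x + (1 - s) * y.
Proof.
move=> s0 s1 x0 y0; have s'0 : 0 < 1 - s by rewrite subr_gt0.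
have := @conjugate_powR R (x `^ s) (y `^ (1 - s)) s^-1 (1 - s)^-1.
rewrite !powR_ge0 !invr_gt0 s0 s'0 !invrK => /(_ isT isT isT isT).
rewrite !powRK ?gt_eqF// => H; rewrite (mulrC s) (mulrC (1 - s)); apply: H.
by ring.
Qed.

(** The convex function [x^c] lies above its tangent at [a]. No derivative is taken: Young's
    inequality with weight [c^-1] is applied to [b^c] and [a^c]. That needs [1 < c], so [c = 1] is
    settled first. *)
Lemma bernoulli_powR c a b : 1 <= c -> 0 <= b -> b <= a ->
  a `^ c - b `^ c <= c * a `^ (c - 1) * (a - b).
Proof.
move=> c1 b0 ba; have a0 : 0 <= a by exact: le_trans ba.
have c0 : 0 < c by exact: lt_le_trans c1.
have [->|cn1] := eqVneq c 1.
  by rewrite subrr powRr0 !powRr1// mulr1 mul1r.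
have {}c1 : 1 < c by rewrite lt_neqAle eq_sym cn1.
have ci1 : c^-1 < 1 by rewrite invf_lt1.
have := @young c^-1 (b `^ c) (a `^ c).
rewrite invr_gt0 c0 ci1 !powR_ge0 => /(_ isT isT isT isT).
rewrite powRK ?gt_eqF// -powRrM.
have -> : c * (1 - c^-1) = c - 1 by field; rewrite gt_eqF.
have E : a `^ c = a * a `^ (c - 1) by rewrite mulr_powRB1.
rewrite -(ler_pM2l c0) => H.
have {H} : c * (b * a `^ (c - 1)) <= b `^ c + (c - 1) * a `^ c.
  apply: le_trans H _; rewrite le_eqVlt; apply/orP; left; apply/eqP.
  by field; rewrite gt_eqF.
rewrite E; set t := a `^ (c - 1); set s := b `^ c; nra.
Qed.

(** The sum of the two powers replaces their maximum and keeps the bound symmetric; on the mesh, a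
    translation lets both terms be treated alike. *)
Lemma powR_diff_le c x y : 1 <= c -> 0 <= x -> 0 <= y ->
  `|x `^ c - y `^ c| <= c * (x `^ (c - 1) + y `^ (c - 1)) * `|x - y|.
Proof.
move=> c1; wlog yx : x y / y <= x => [H x0 y0|x0 y0].
  have [yx|/ltW xy] := leP y x; first by apply: H.
  by rewrite distrC (distrC x) [X in c * X]addrC; apply: H.
have c0 : 0 <= c by exact: le_trans c1.
rewrite !ger0_norm ?subr_ge0//; last exact: powR_le.
apply: le_trans (bernoulli_powR c1 y0 yx) _.
apply: ler_wpM2r; first by rewrite subr_ge0.
by apply: ler_wpM2l => //; rewrite lerDl powR_ge0.
Qed.

(* The sharp constant is [c ^+ 2 / (2 * c - 1)]; [c ^+ 2] suffices for the iteration. *)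
Lemma stroock_varopoulos c x y : 1 <= c -> 0 <= x -> 0 <= y ->
  (x `^ c - y `^ c) ^+ 2
    <= c ^+ 2 * ((x - y) * (x `^ (2 * c - 1) - y `^ (2 * c - 1))).
Proof.
move=> c1; wlog yx : x y / y <= x => [H x0 y0|x0 y0].
  have [yx|/ltW xy] := leP y x; first by apply: H.
  have := H _ _ xy y0 x0; set X := _ ^+ 2; set Y := _ * (_ * _) => XY.
  have -> : (x `^ c - y `^ c) ^+ 2 = X by rewrite /X; ring.
  by apply: le_trans XY _; rewrite /Y le_eqVlt; apply/orP; left; apply/eqP; ring.
have c0 : 0 < c by exact: lt_le_trans c1.
have B := bernoulli_powR c1 y0 yx.
have XY : y `^ c <= x `^ c by apply: powR_le => //; exact: ltW.
have E (z : R) : z `^ (2 * c - 1) = z `^ c * z `^ (c - 1).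
  have -> : 2 * c - 1 = c + (c - 1) by ring.
  by rewrite powRDp//; lra.
rewrite !E.
have G : y `^ (c - 1) <= x `^ (c - 1) by apply: powR_le => //; rewrite subr_ge0.
have := powR_ge0 y (c - 1); have := powR_ge0 y c; move: B XY G.
set X := x `^ c; set Y := y `^ c; set X' := x `^ (c - 1); set Y' := y `^ (c - 1).
move=> B XY G Y0 Y'0.
(* One factor [X - Y] is replaced by its tangent bound; the other is multiplied by [X'], and
   [Y' <= X'] gives [H2]. *)
have H1 : (X - Y) ^+ 2 <= (c * X' * (x - y)) * (X - Y).
  by rewrite expr2; apply: ler_wpM2r => //; rewrite subr_ge0.
apply: (le_trans H1).
have H2 : X' * (X - Y) <= X * X' - Y * Y'.
  have := mulr_ge0 Y0 (_ : 0 <= X' - Y'); rewrite subr_ge0 => /(_ G); nra.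
have xy0 : 0 <= x - y by rewrite subr_ge0.
have H3 : 0 <= X' * (X - Y).
  by rewrite mulr_ge0 ?subr_ge0//; exact: le_trans G.
have H4 : c * ((x - y) * (X' * (X - Y))) <= c * ((x - y) * (X * X' - Y * Y')).
  by apply: ler_wpM2l; [exact: ltW|apply: ler_wpM2l].
have H5 : 0 <= (x - y) * (X * X' - Y * Y').
  by rewrite mulr_ge0//; exact: le_trans H2.
have H6 : c * ((x - y) * (X * X' - Y * Y')) <= c ^+ 2 * ((x - y) * (X * X' - Y * Y')).
  apply: ler_wpM2r => //; nra.
apply: le_trans H6; apply: le_trans H4; nra.
Qed.

(** Signs only help: a cross term such as [y * (Num.sg x * X)] is at most [|y| * X], and the
    diagonal terms already equal the unsigned ones. *)
Lemma stroock_varopoulos_signed c x y : 1 <= c ->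
  (`|x| `^ c - `|y| `^ c) ^+ 2 <= c ^+ 2 * ((x - y) *
    (Num.sg x * `|x| `^ (2 * c - 1) - Num.sg y * `|y| `^ (2 * c - 1))).
Proof.
move=> c1; apply: le_trans (stroock_varopoulos c1 (normr_ge0 x) (normr_ge0 y)) _.
apply: ler_wpM2l; first exact: sqr_ge0.
have H (s t z : R) : 0 <= z -> s * (Num.sg t * z) <= `|s| * z.
  move=> z0; rewrite mulrA; apply: ler_wpM2r => //.
  apply: le_trans (ler_norm _) _; rewrite normrM.
  by rewrite ler_piMr// normr_sg; case: eqP.
have D (s z : R) : s * (Num.sg s * z) = `|s| * z.
  by rewrite mulrA (mulrC s) -normrEsg.
have := H x y _ (powR_ge0 `|y| (2 * c - 1)); have := H y x _ (powR_ge0 `|x| (2 * c - 1)).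
have := D x (`|x| `^ (2 * c - 1)); have := D y (`|y| `^ (2 * c - 1)).
set X := `|x| `^ _; set Y := `|y| `^ _.
set sx := Num.sg x * X; set sy := Num.sg y * Y.
rewrite !mulrBl !mulrBr; lra.
Qed.

(** * Hoelder's inequality and its relatives for finite sums *)

Section FiniteHoelder.
Variables (I : finType) (P : pred I).

(** Young's inequality is applied to each product of [f i / a] and [g i / b]; the normalised power
    sums are 1, and the weights [p^-1] and [q^-1] add up to 1. *)
Lemma hoelder_normalized (f g : I -> R) (a b p q : R) :
  0 < p -> 0 < q -> p^-1 + q^-1 = 1 ->
  (forall i, P i -> 0 <= f i) -> (forall i, P i -> 0 <= g i) ->
  0 < a -> 0 < b -> a `^ p = \sum_(i | P i) f i `^ p ->
  b `^ q = \sum_(i | P i) g i `^ q -> \sum_(i | P i) f i * g i <= a * b.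
Proof.
move=> p0 q0 pq f0 g0 a0 b0 ap bq.
have -> : \sum_(i | P i) f i * g i =
    a * b * \sum_(i | P i) (f i / a) * (g i / b).
  rewrite mulr_sumr; apply: eq_bigr => i _.
  by rewrite mulrACA ![_ * (_ / _)]mulrC !divfK ?(gt_eqF a0) ?(gt_eqF b0).
have ab0 : 0 <= a * b by rewrite mulr_ge0 ?ltW.
rewrite ler_piMr//.
have H i : P i ->
    f i / a * (g i / b) <= f i `^ p / (a `^ p * p) + g i `^ q / (b `^ q * q).
  move=> Pi; have fi := f0 i Pi; have gi := g0 i Pi.
  apply: le_trans (conjugate_powR _ _ p0 q0 pq) _;
    rewrite ?divr_ge0 ?(ltW a0) ?(ltW b0)//.
  rewrite !powRM ?invr_ge0 ?(ltW a0) ?(ltW b0)// !powRV ?(ltW a0) ?(ltW b0)//.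
  by rewrite !invfM !mulrA.
apply: le_trans (ler_sum _ H) _; rewrite big_split/= -!mulr_suml -ap -bq.
rewrite !invfM !mulrA !divff ?gt_eqF ?powR_gt0// !mul1r.
by rewrite pq.
Qed.

Lemma hoelder_sum (f g : I -> R) p q : 0 < p -> 0 < q -> p^-1 + q^-1 = 1 ->
  (forall i, P i -> 0 <= f i) -> (forall i, P i -> 0 <= g i) ->
  \sum_(i | P i) f i * g i <=
  (\sum_(i | P i) f i `^ p) `^ p^-1 * (\sum_(i | P i) g i `^ q) `^ q^-1.
Proof.
move=> p0 q0 pq f0 g0.
set A := \sum_(i | P i) f i `^ p; set B := \sum_(i | P i) g i `^ q.
have A0 : 0 <= A by apply: sumr_ge0 => i _; exact: powR_ge0.
have B0 : 0 <= B by apply: sumr_ge0 => i _; exact: powR_ge0.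
(* A vanishing power sum cannot be normalised, but then all its terms are 0 and so is the left
   side. *)
have Z (h : I -> R) (r : R) : (forall i, P i -> 0 <= h i) ->
    \sum_(i | P i) h i `^ r = 0 -> forall i, P i -> h i = 0.
  move=> h0 /eqP; rewrite psumr_eq0 => [/allP H i Pi|i _]; last exact: powR_ge0.
  have := H i (mem_index_enum i); rewrite Pi => /eqP; exact: powR_eq0_eq0.
have [A0'|An0] := eqVneq A 0.
  rewrite big1 ?mulr_ge0 ?powR_ge0// => i Pi.
  by rewrite (Z f p f0 A0' i Pi) mul0r.
have [B0'|Bn0] := eqVneq B 0.
  rewrite big1 ?mulr_ge0 ?powR_ge0// => i Pi.
  by rewrite (Z g q g0 B0' i Pi) mulr0.
have Ap : 0 < A by rewrite lt_neqAle eq_sym An0.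
have Bp : 0 < B by rewrite lt_neqAle eq_sym Bn0.
by apply: (@hoelder_normalized _ _ _ _ p q); rewrite ?powR_gt0 ?powRVK ?gt_eqF.
Qed.

Lemma cauchy_schwarz_sum (f g : I -> R) :
  (forall i, P i -> 0 <= f i) -> (forall i, P i -> 0 <= g i) ->
  \sum_(i | P i) f i * g i <=
  Num.sqrt (\sum_(i | P i) f i ^+ 2) * Num.sqrt (\sum_(i | P i) g i ^+ 2).
Proof.
move=> f0 g0; apply: le_trans (@hoelder_sum f g 2 2 _ _ _ f0 g0) _ => //.
  by field.
rewrite !powR12_sqrt; try by apply: sumr_ge0 => i _; exact: powR_ge0.
suff E (h : I -> R) : (forall i, P i -> 0 <= h i) ->
    \sum_(i | P i) h i `^ 2 = \sum_(i | P i) h i ^+ 2 by rewrite !E.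
by move=> h0; apply: eq_bigr => i Pi; rewrite powR_mulrn ?h0.
Qed.

End FiniteHoelder.

Lemma AGM_root (J : finType) (Q : pred J) (x : J -> R) : (0 < #|Q|)%N ->
  (forall j, Q j -> 0 <= x j) ->
  \prod_(j | Q j) x j `^ (#|Q|%:R)^-1 <= (\sum_(j | Q j) x j) / #|Q|%:R.
Proof.
move=> Q0 x0; rewrite -powR_prod//.
have m0 : 0 < #|Q|%:R :> R by rewrite ltr0n.
have [H _] := @leif_AGM R J Q x x0.
have S0 : 0 <= (\sum_(j | Q j) x j) / #|Q|%:R.
  by rewrite divr_ge0 ?ler0n// sumr_ge0.
rewrite -[leRHS](@powRK #|Q|%:R) ?gt_eqF//; apply: powR_le.
- by rewrite invr_ge0 ler0n.
- exact: prodr_ge0.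
- by rewrite powR_mulrn.
Qed.

(** After division of each [f j] by its sum, the geometric mean over [j] is at most the arithmetic
    mean, whose sum over [i] is 1. If one of the sums is 0, the left side vanishes. *)
Lemma hoelder_prod (I J : finType) (Q : pred J) (f : J -> I -> R) :
  (0 < #|Q|)%N -> (forall j i, Q j -> 0 <= f j i) ->
  \sum_i \prod_(j | Q j) f j i `^ (#|Q|%:R)^-1 <=
  \prod_(j | Q j) (\sum_i f j i) `^ (#|Q|%:R)^-1.
Proof.
move=> Q0 f0; set m := #|Q|%:R.
have m0 : 0 < m :> R by rewrite ltr0n.
have S0 j : Q j -> 0 <= \sum_i f j i by move=> Qj; apply: sumr_ge0 => i _; exact: f0.
have [|] := boolP [exists j, Q j && (\sum_i f j i == 0)].
  move=> /existsP[j /andP[Qj /eqP Sj]]; rewrite big1.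
    by apply: prodr_ge0 => *; exact: powR_ge0.
  move=> i _; rewrite (bigD1 j)//=.
  move/eqP: Sj; rewrite psumr_eq0 => [/allP/(_ i (mem_index_enum i))/eqP ->|*].
    by rewrite powR0 ?mul0r// invr_eq0 gt_eqF.
  exact: f0.
rewrite negb_exists => /forallP H.
have Sp j : Q j -> 0 < \sum_i f j i.
  by move=> Qj; have := H j; rewrite Qj/= lt_neqAle eq_sym S0// andbT.
rewrite -[leRHS]mulr1.
have -> : \sum_i \prod_(j | Q j) f j i `^ m^-1 =
   \prod_(j | Q j) (\sum_i f j i) `^ m^-1 *
   \sum_i \prod_(j | Q j) (f j i / (\sum_i f j i)) `^ m^-1.
  rewrite mulr_sumr; apply: eq_bigr => i _; rewrite -big_split/=.
  apply: eq_bigr => j Qj; rewrite -powRM ?S0 ?divr_ge0 ?f0 ?S0//.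
  by rewrite mulrC divfK// gt_eqF// Sp.
apply: ler_wpM2l; first by apply: prodr_ge0 => *; exact: powR_ge0.
apply: (@le_trans _ _ (\sum_i (\sum_(j | Q j) f j i / (\sum_i f j i)) / m)).
  by apply: ler_sum => i _; apply: AGM_root => // j Qj; rewrite divr_ge0 ?f0 ?S0.
rewrite -mulr_suml exchange_big/= ler_pdivrMr// mul1r.
under eq_bigr => j Qj do rewrite -mulr_suml divff ?gt_eqF ?Sp//.
by rewrite sumr_const.
Qed.

End RealInequalities.

(** * The Loomis-Whitney inequality on a finite product *)

Section LoomisWhitney.
Import mathcomp.boot.finset.
Context {R : realType} {I S : finType}.
Local Notation X := {ffun I -> S}.
Implicit Types (J : {set I}) (p : X) (f : X -> R).

Definition upd p j s : X := [ffun i => if i == j then s else p i].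

(* [psum J f p] sums [f] over the coordinates in [J], the other ones being frozen at [p]. *)
Definition psum J f p : R :=
  \sum_(q : X | [forall i, (i \notin J) ==> (q i == p i)]) f q.

Lemma psum_ge0 J f p : (forall q, 0 <= f q) -> 0 <= psum J f p.
Proof. by move=> f0; apply: sumr_ge0. Qed.

Lemma psum_set0 f p : psum set0 f p = f p.
Proof.
rewrite /psum (big_pred1 p)// => q /=; apply/forallP/eqP => [H|-> i].
  by apply/ffunP => i; have := H i; rewrite inE => /eqP.
by rewrite eqxx implybT.
Qed.

Lemma psum_setT f p : psum setT f p = \sum_q f q.
Proof. by apply: eq_bigl => q; apply/forallP => i; rewrite inE. Qed.

Lemma psum_setU1 J j f p : j \notin J ->
  psum (j |: J) f p = \sum_s psum J f (upd p j s).
Proof.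
move=> jJ; rewrite /psum (partition_big (fun q : X => q j) predT)//=.
apply: eq_bigr => s _; apply: eq_bigl => q; apply/andP/forallP.
  move=> [/forallP H /eqP qj] i; rewrite ffunE; have := H i; rewrite !inE negb_or.
  by have [->|] := eqVneq i j; rewrite ?qj ?eqxx ?implybT.
move=> H; split; last by have := H j; rewrite jJ ffunE eqxx.
apply/forallP => i; have := H i; rewrite ffunE !inE negb_or.
by have [->|_] := eqVneq i j; rewrite ?implybT.
Qed.

Lemma psum_upd J j s f p : j \in J -> psum J f (upd p j s) = psum J f p.
Proof.
move=> jJ; apply: eq_bigl => q; apply: eq_forallb => i; rewrite ffunE.
by have [->|//] := eqVneq i j; rewrite jJ.
Qed.

Lemma psum_set1 j f p : psum [set j] f p = \sum_s f (upd p j s).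
Proof.
rewrite -[[set j]]setU0 psum_setU1 ?inE//.
by apply: eq_bigr => s _; rewrite psum_set0.
Qed.

(** Factor [i] does not depend on coordinate [i]. The coordinates are summed one at a time: when [j]
    is summed, factor [j] is a constant, and [hoelder_prod] handles the [#|I|.-1] others. *)
Lemma loomis_whitney (d : I -> X -> R) : (1 < #|I|)%N ->
  (forall i p, 0 <= d i p) ->
  \sum_p \prod_i (\sum_s d i (upd p i s)) `^ (#|I|.-1%:R)^-1 <=
  \prod_i (\sum_p d i p) `^ (#|I|.-1%:R)^-1.
Proof.
move=> I1 d0; set m := _^-1.
(* A point of [S] is needed as base point for [psum setT]; if [S] is empty there is no [p] to sum
   over. *)
have [S0|/card_gt0P[s0 _]] := posnP #|S|.
  rewrite [leLHS]big1 => [|p _].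
    by apply: prodr_ge0 => i _; exact: powR_ge0.
  have /card_gt0P[i _] : (0 < #|I|)%N by exact: ltn_trans I1.
  by have := fintype0 (p i) S0.
pose G p := \prod_i psum [set i] (d i) p `^ m.
(* The form that passes through induction on [#|J|]: an equality for the empty set, the claim for
   [setT]. *)
suff H J p : psum J G p <= \prod_i psum (i |: J) (d i) p `^ m.
  have -> : \sum_p \prod_i (\sum_s d i (upd p i s)) `^ m = \sum_p G p.
    by apply: eq_bigr => p _; apply: eq_bigr => i _; rewrite psum_set1.
  rewrite -(psum_setT G [ffun _ => s0]); apply: le_trans (H _ _) _.
  by under eq_bigr do rewrite setUT psum_setT.
move: {2}#|J| (erefl #|J|) => k; elim: k J p => [|k IH] J p Jk.
  move/eqP: Jk; rewrite cards_eq0 => /eqP ->; rewrite psum_set0.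
  by rewrite le_eqVlt; apply/orP; left; apply/eqP/eq_bigr => i _; rewrite setU0.
have /card_gt0P[j jJ] : (0 < #|J|)%N by rewrite Jk.
rewrite -(setD1K jJ); set J' := J :\ j.
have jJ' : j \notin J' by rewrite !inE eqxx.
have J'k : #|J'| = k by have := cardsD1 j J; rewrite Jk jJ add1n => -[].
rewrite psum_setU1//; apply: le_trans (ler_sum _ (fun s _ => IH J' _ J'k)) _.
rewrite (bigD1 j)//=.
rewrite -/J' setUA setUid.
have E s : \prod_i psum (i |: J') (d i) (upd p j s) `^ m =
    psum (j |: J') (d j) p `^ m *
    \prod_(i | i != j) psum (i |: J') (d i) (upd p j s) `^ m.
  by rewrite (bigD1 j)//= psum_upd// !inE eqxx.
under eq_bigr => s _ do rewrite E.
rewrite -mulr_sumr; apply: ler_wpM2l; first exact: powR_ge0.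
have Q : #|[pred i | i != j]| = #|I|.-1 by rewrite cardC1.
have := @hoelder_prod R S I [pred i | i != j]
  (fun i s => psum (i |: J') (d i) (upd p j s)).
rewrite Q => /(_ _ _)/le_trans; apply.
- by rewrite -ltnS prednK// (ltn_trans _ I1).
- by move=> i s _; apply: psum_ge0.
- rewrite le_eqVlt; apply/orP; left; apply/eqP.
  apply: eq_bigr => i ij; rewrite -psum_setU1 1?setUCA//.
  by rewrite finset.in_setU finset.in_set1 negb_or jJ' andbT eq_sym.
Qed.

End LoomisWhitney.

(** * Sums, translations and differences on the mesh *)

Section GridFunctions.
Context {R : realType} {n : nat} {h : 'I_n -> R} {k l : 'I_n -> int}.
Hypotheses (h0 : forall i, 0 < h i) (kl : forall i, k i + 1 < l i).
Local Notation point := ('I_n -> int).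
Local Notation grid := {ffun 'I_n -> 'I_(gsize k l)}.
Local Notation H := (hvol h).
Implicit Types (f v w u : point -> R) (z : point) (p : grid) (i : 'I_n).

Definition gall f : R := \sum_(p : grid) f (gpt p).

(* Functions with [interior_supp] are defined on the whole lattice, so that shifts and finite
   differences need no boundary cases; [gall] sums over a box that contains the closed mesh. *)
Definition interior_supp v := forall z, ~~ inint k l z -> v z = 0.

Definition powsum (r : R) v : R := gall (fun z => `|v z| `^ r * H).

Lemma hvol_gt0 : 0 < H.
Proof. exact: prodr_gt0. Qed.

Lemma ltn_gsize i : (`|l i - k i| < gsize k l)%N.
Proof. by rewrite ltnS; exact: (leq_bigmax i). Qed.

Lemma absz_side i : `|l i - k i|%:Z = l i - k i.
Proof. by rewrite gez0_abs// subr_ge0 ltW// (lt_trans _ (kl i))// ltrDl. Qed.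

Lemma gpt_upd p i s :
  gpt (upd p i s) = (fun j => if j == i then k i + (nat_of_ord s)%:Z else gpt p j).
Proof.
by apply/funext => j; rewrite /gpt ffunE; case: eqVneq => [->|].
Qed.

Lemma not_inint_le z i : z i <= k i -> ~~ inint k l z.
Proof.
by move=> zk; apply/forallP => /(_ i)/andP[/lt_le_trans/(_ zk)]; rewrite ltxx.
Qed.

Lemma not_inint_ge z i : l i <= z i -> ~~ inint k l z.
Proof.
by move=> zl; apply/forallP => /(_ i)/andP[_ /(le_lt_trans zl)]; rewrite ltxx.
Qed.

Lemma shift_id z i (s : int) : shift z i s i = z i + s.
Proof. by rewrite /shift eqxx. Qed.

Lemma shiftK z i : shift (shift z i 1) i (-1) = z.
Proof. by apply/funext => j; rewrite /shift; case: eqP => // _; rewrite addrK. Qed.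

(** The translation is compared with the cyclic shift of the index box, a bijection. They differ
    only at the last index, where the true shift lies beyond [l i] and the cyclic one has coordinate
    [k i]; [f] vanishes at both. *)
Lemma gall_shift i f : interior_supp f -> gall (fun z => f (shift z i 1)) = gall f.
Proof.
move=> f0; pose sh p : grid := upd p i (ordS (p i)).
have shI : injective sh.
  move=> p q /ffunP E; apply/ffunP => j; have := E j; rewrite !ffunE.
  case: eqVneq => [->|//] /(congr1 (@ord_pred _)).
  by rewrite !ordSK.
rewrite [RHS](reindex_inj shI); apply: eq_bigr => p _ /=.
have := ltn_ord (p i); rewrite leq_eqVlt => /orP[/eqP pi|pi].
  rewrite f0; last first.
    apply: (@not_inint_ge _ i); rewrite shift_id /gpt -addrA addrC -lerBlDr.
    by rewrite -absz_side -PoszD lez_nat addn1 pi ltnW// ltn_gsize.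
  rewrite f0//; apply: (@not_inint_le _ i).
  by rewrite gpt_upd eqxx /= pi modnn addr0.
congr f; rewrite gpt_upd; apply/funext => j; rewrite /shift /=; have [->|//] := eqVneq j i.
by rewrite /gpt /= modn_small// -addrA -PoszD addn1.
Qed.

Lemma interior_supp_mull f v : interior_supp f -> interior_supp (fun z => f z * v z).
Proof. by move=> f0 z /f0 ->; rewrite mul0r. Qed.

(** Summation by parts: the second difference is split into two one-sided ones, and the term with
    the backward one is translated by one step. *)
Lemma gall_by_parts i v f : interior_supp f ->
  gall (fun z => f z * (2 * v z - v (shift z i 1) - v (shift z i (-1)))) =
  gall (fun z => (v (shift z i 1) - v z) * (f (shift z i 1) - f z)).
Proof.
move=> f0.
have E := gall_shift i (@interior_supp_mull _ (fun z => v z - v (shift z i (-1))) f0).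
rewrite [LHS](_ : _ = gall (fun z => f z * (v z - v (shift z i 1))) +
   gall (fun z => f z * (v z - v (shift z i (-1))))).
  rewrite -E -big_split; apply: eq_bigr => p _ /=.
  by rewrite shiftK; ring.
by rewrite -big_split; apply: eq_bigr => p _ /=; ring.
Qed.

(** Telescoping in direction [i] from the face with coordinate [k i], where [w] vanishes. Extending
    the sum to the full line makes the bound independent of [p i], as Loomis-Whitney requires. *)
Lemma line_bound w p i : interior_supp w ->
  `|w (gpt p)| <= \sum_s `|w (shift (gpt (upd p i s)) i 1) - w (gpt (upd p i s))|.
Proof.
move=> w0; pose f m := w (fun j => if j == i then k i + m%:Z else gpt p j).
have -> : gpt p = (fun j => if j == i then k i + (nat_of_ord (p i))%:Z else gpt p j).
  by apply/funext => j /=; have [->|] := eqVneq j i.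
have -> : \sum_s `|w (shift (gpt (upd p i s)) i 1) - w (gpt (upd p i s))| =
    \sum_(s < gsize k l) `|f s.+1 - f s|.
  apply: eq_bigr => s _; rewrite !gpt_upd; congr (`|_ - _|); congr w.
  apply/funext => j; rewrite /shift; have [_|//] := eqVneq j i.
  by rewrite -addrA -PoszD addn1.
have H m : `|f m| <= \sum_(s < m) `|f s.+1 - f s|.
  elim: m => [|m IH].
    by rewrite big_ord0 /f w0 ?normr0//; apply: (@not_inint_le _ i); rewrite eqxx addr0.
  rewrite big_ord_recr/= -[X in `|X| <= _](subrK (f m)).
  by apply: le_trans (ler_normD _ _) _; rewrite [leLHS]addrC lerD.
apply: le_trans (H (p i)) _.
rewrite -(big_mkord predT (fun s => `|f s.+1 - f s|)).
rewrite -(big_mkord predT (fun s => `|f s.+1 - f s|)).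
rewrite [leRHS](big_cat_nat (n := p i)) ?(ltnW (ltn_ord _))//=.
by rewrite lerDl sumr_ge0.
Qed.

(** The power on the left is a product of [n] factors with exponent [(n.-1)^-1]; each is bounded by
    the line sum in its own direction. *)
Lemma gagliardo_nirenberg w : (1 < n)%N -> interior_supp w ->
  gall (fun z => `|w z| `^ (n%:R / n.-1%:R)) <=
  \prod_(i < n) (gall (fun z => `|w (shift z i 1) - w z|)) `^ (n.-1%:R)^-1.
Proof.
move=> n1 w0.
have := @loomis_whitney R 'I_n 'I_(gsize k l)
  (fun i p => `|w (shift (gpt p) i 1) - w (gpt p)|).
rewrite card_ord n1 => /(_ isT (fun _ _ => normr_ge0 _)); apply: le_trans.
apply: ler_sum => p _.
have -> : `|w (gpt p)| `^ (n%:R / n.-1%:R) = \prod_(i < n) `|w (gpt p)| `^ (n.-1%:R)^-1.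
  by rewrite prodr_const card_ord mulrC powRrM powR_mulrn ?powR_ge0.
apply: ler_prod => i _; rewrite powR_ge0/=; apply: powR_le => //.
  by rewrite invr_ge0 ler0n.
exact: line_bound.
Qed.

(** Outside [notup i] neither [z] nor its shift is interior, so the extra difference quotients are
    0. *)
Lemma Dnorm_gall v : interior_supp v ->
  Dnorm h k l v = Num.sqrt (\sum_i gall (fun z => Dplus h v i z ^+ 2 * H)).
Proof.
move=> v0; congr Num.sqrt; apply: eq_bigr => i _.
rewrite /gsum big_mkcond; apply: eq_bigr => p _ /=; case: ifPn => //.
set z := gpt p => Hz.
rewrite /Dplus !v0 ?subrr ?mul0r ?expr0n ?mul0r//.
- move: Hz; rewrite /notup /inbar; rewrite negb_and negb_and negbK.
  rewrite orbA orbb => /orP[|/eqP zl]; last by apply: (@not_inint_ge _ i); rewrite zl.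
  rewrite negb_forall => /existsP[j]; rewrite negb_and -!ltNge => /orP[/ltW|/ltW].
    exact: not_inint_le.
  exact: not_inint_ge.
- move: Hz; rewrite /notup /inbar; rewrite negb_and negb_and negbK.
  rewrite orbA orbb => /orP[|/eqP zl]; last first.
    by apply: (@not_inint_ge _ i); rewrite shift_id zl lerDl.
  rewrite negb_forall => /existsP[j]; rewrite negb_and -!ltNge => /orP[zj|zj].
    apply: (@not_inint_le _ j); rewrite /shift; case: eqP => [|_]; last exact: ltW.
    by move: zj; rewrite -lezD1.
  apply: (@not_inint_ge _ j); rewrite /shift; case: eqP => [_|_]; last exact: ltW.
  by apply: le_trans (ltW zj) _; rewrite lerDl.
Qed.

Lemma powsum_ge0 (r : R) v : 0 <= powsum r v.
Proof.
by apply: sumr_ge0 => p _; rewrite mulr_ge0 ?powR_ge0 ?(ltW hvol_gt0).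
Qed.

Lemma Lrnorm_powsum (r : R) v : 0 < r -> interior_supp v ->
  Lrnorm h k l r (inbar k l) v = powsum r v `^ r^-1.
Proof.
move=> r0 v0; congr (_ `^ _); rewrite /gsum big_mkcond; apply: eq_bigr => p _ /=.
case: ifPn => //; rewrite andbb => /forallPn[j]; rewrite negb_and -!ltNge => Hj.
rewrite v0 ?normr0 ?powR0 ?mul0r ?gt_eqF//.
by case/orP: Hj => /ltW; [exact: not_inint_le|exact: not_inint_ge].
Qed.

End GridFunctions.

(** * Discrete Sobolev inequalities *)

Section Sobolev.
Context {R : realType} {n : nat} {h : 'I_n -> R} {k l : 'I_n -> int}.
Hypotheses (h0 : forall i, 0 < h i) (kl : forall i, k i + 1 < l i) (n1 : (1 < n)%N).
Local Notation point := ('I_n -> int).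
Local Notation H := (hvol h).
Local Notation gall := (@gall R n k l).
Local Notation powsum := (@powsum R n h k l).
Local Notation interior_supp := (@interior_supp R n k l).
Implicit Types (f v w u : point -> R) (z : point) (i : 'I_n) (t : R).

Lemma gall_ge0 f : (forall z, 0 <= f z) -> 0 <= gall f.
Proof. by move=> f0; apply: sumr_ge0. Qed.

Lemma cauchy_schwarz_gall f w : (forall z, 0 <= f z) -> (forall z, 0 <= w z) ->
  gall (fun z => f z * w z * H) <=
  Num.sqrt (gall (fun z => f z ^+ 2 * H)) * Num.sqrt (gall (fun z => w z ^+ 2 * H)).
Proof.
move=> f0 w0; have H0 := hvol_gt0 h0; pose s := Num.sqrt H.
have s2 : s ^+ 2 = H by rewrite sqr_sqrtr// ltW.
have s0 : 0 <= s by exact: sqrtr_ge0.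
rewrite -s2.
have -> : gall (fun z => f z * w z * s ^+ 2) = gall (fun z => (f z * s) * (w z * s)).
  by apply: eq_bigr => p _; ring.
apply: le_trans (cauchy_schwarz_sum _ _) _ => [p _|p _|]; try exact: mulr_ge0.
rewrite le_eqVlt; apply/orP; left; apply/eqP; congr (Num.sqrt _ * Num.sqrt _);
  by apply: eq_bigr => p _; rewrite exprMn.
Qed.

Let energy v i : R := gall (fun z => Dplus h v i z ^+ 2 * H).

(** [powR_diff_le] produces weights [|v|^(t - 1)] at [z] and at its neighbour. Cauchy-Schwarz is
    applied to each, and translation equates the two weight sums. The factor [H / h i] turns
    differences into difference quotients times the cell volume. *)
Lemma slope_bound v t i : 1 < t -> interior_supp v ->
  gall (fun z => `| `|v (shift z i 1)| `^ t - `|v z| `^ t|) * (H / h i) <=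
  2 * t * Num.sqrt (powsum (2 * (t - 1)) v) * Num.sqrt (energy v i).
Proof.
move=> t1 v0; have H0 := hvol_gt0 h0; have t0 : 0 <= t by lra.
have hi : h i != 0 by rewrite gt_eqF.
pose D z := `|Dplus h v i z|; pose A z := `|v z| `^ (t - 1).
have D0 z : 0 <= D z by exact: normr_ge0.
have A0 z : 0 <= A z by exact: powR_ge0.
have A2 z : A z ^+ 2 = `|v z| `^ (2 * (t - 1)) by rewrite powR_pow2.
have D2 : gall (fun z => D z ^+ 2 * H) = energy v i.
  by apply: eq_bigr => p _; rewrite /D real_normK ?num_real.
have CS1 : gall (fun z => A z * D z * H) <=
    Num.sqrt (powsum (2 * (t - 1)) v) * Num.sqrt (energy v i).
  apply: le_trans (cauchy_schwarz_gall A0 D0) _; rewrite D2.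
  by under [X in Num.sqrt X * _]eq_bigr do rewrite A2.
have CS2 : gall (fun z => A (shift z i 1) * D z * H) <=
    Num.sqrt (powsum (2 * (t - 1)) v) * Num.sqrt (energy v i).
  apply: le_trans (cauchy_schwarz_gall (fun z => A0 (shift z i 1)) D0) _; rewrite D2.
  suff -> : gall (fun z => A (shift z i 1) ^+ 2 * H) = powsum (2 * (t - 1)) v by [].
  transitivity (gall (fun z => (fun z => `|v z| `^ (2 * (t - 1)) * H) (shift z i 1))).
    by apply: eq_bigr => p _; rewrite A2.
  apply: gall_shift => // z vz.
  by rewrite v0// normr0 powR0 ?mul0r// mulf_neq0// gt_eqF// subr_gt0.
apply: (@le_trans _ _ (t * gall (fun z => A (shift z i 1) * D z * H) +
    t * gall (fun z => A z * D z * H))).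
  rewrite mulr_suml !mulr_sumr -big_split/=; apply: ler_sum => p _.
  set z := gpt p; rewrite -mulrDr.
  have -> : t * (A (shift z i 1) * D z * H + A z * D z * H) =
      t * (A (shift z i 1) + A z) * `|v (shift z i 1) - v z| * (H / h i).
    rewrite /D /Dplus normrM normfV (gtr0_norm (h0 i)).
    by field.
  apply: ler_wpM2r; first by rewrite divr_ge0// ltW.
  apply: le_trans (powR_diff_le (ltW t1) (normr_ge0 _) (normr_ge0 _)) _.
  apply: ler_wpM2l; last exact: ler_dist_dist.
  by rewrite mulr_ge0// addr_ge0 ?powR_ge0.
have := ler_wpM2l t0 CS1; have := ler_wpM2l t0 CS2; lra.
Qed.

Lemma sum_energy v : interior_supp v -> \sum_i energy v i = Dnorm h k l v ^+ 2.
Proof.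
move=> v0; rewrite Dnorm_gall// sqr_sqrtr//; apply: sumr_ge0 => i _.
by apply: gall_ge0 => z; rewrite mulr_ge0 ?sqr_ge0// ltW// hvol_gt0.
Qed.

(* Gagliardo-Nirenberg applied to [`|v| `^ t]. *)
Lemma sobolev_power v t : 1 < t -> interior_supp v ->
  powsum (t * (n%:R / n.-1%:R)) v <=
  (2 * t / Num.sqrt n%:R * Num.sqrt (powsum (2 * (t - 1)) v) * Dnorm h k l v)
    `^ (n%:R / n.-1%:R).
Proof.
move=> t1 v0; have H0 := hvol_gt0 h0; have t0 : 0 < t by lra.
have n0 : 0 < n%:R :> R by rewrite ltr0n ltnW.
have m0 : 0 < n.-1%:R :> R by rewrite ltr0n -ltnS prednK// ltnW.
have nm : n%:R = 1 + n.-1%:R :> R by rewrite -{1}(prednK (ltnW n1)) -addn1 natrD addrC.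
set m := n.-1%:R in m0 nm *.
pose w z := `|v z| `^ t.
have w0 : interior_supp w by move=> z vz; rewrite /w v0// normr0 powR0// gt_eqF.
have GN := gagliardo_nirenberg n1 w0.
pose a i := gall (fun z => `|w (shift z i 1) - w z|) * (H / h i).
have a0 i : 0 <= a i.
  by rewrite mulr_ge0 ?gall_ge0// divr_ge0// ltW.
(* The [n] factors [H / h i] multiply to [H^(n-1)], whose root is [H]; this spreads the cell volume
   over the directions. *)
have prodH : \prod_(i < n) (H / h i) `^ m^-1 = H.
  rewrite -powR_prod => [|i _]; last by rewrite divr_ge0// ltW.
  rewrite big_split/= prodr_const card_ord prodfV -/H -powR_mulrn ?(ltW H0)//.
  rewrite nm powRDp ?addr_gt0// powRr1 ?(ltW H0)//.
  by rewrite mulrAC divff ?gt_eqF// mul1r powRK ?gt_eqF// ltW.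
have E1 : powsum (t * (n%:R / m)) v <= \prod_(i < n) a i `^ m^-1.
  have -> : powsum (t * (n%:R / m)) v = gall (fun z => `|w z| `^ (n%:R / m)) * H.
    rewrite mulr_suml; apply: eq_bigr => p _.
    by rewrite /w (ger0_norm (powR_ge0 _ _)) powRrM.
  apply: le_trans (ler_wpM2r (ltW H0) GN) _.
  rewrite -{1}prodH -big_split/= le_eqVlt; apply/orP; left; apply/eqP.
  apply: eq_bigr => i _; rewrite -powRM//; last by rewrite divr_ge0// ltW.
  exact: gall_ge0.
apply: le_trans E1 _.
set c := 2 * t / _ * _ * _.
have c0 : 0 <= c.
  by rewrite !mulr_ge0 ?sqrtr_ge0// ?invr_ge0 ?sqrtr_ge0// ltW.
(* Cauchy-Schwarz over the directions costs [Num.sqrt n]; with the [1 / n] of the arithmetic mean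
   this leaves the [1 / Num.sqrt n] in [c]. *)
have S1 : \sum_(i < n) a i / n%:R <= c.
  rewrite -mulr_suml ler_pdivrMr//.
  set P := Num.sqrt (powsum (2 * (t - 1)) v).
  have P0 : 0 <= P by exact: sqrtr_ge0.
  apply: (@le_trans _ _ (2 * t * P * \sum_(i < n) Num.sqrt (energy v i))).
    by rewrite mulr_sumr; apply: ler_sum => i _; exact: slope_bound.
  have -> : c * n%:R = 2 * t * P * (Num.sqrt n%:R * Dnorm h k l v).
    rewrite /c -/P -{2}(sqr_sqrtr (ltW n0)); field.
    by rewrite gt_eqF// sqrtr_gt0.
  apply: ler_wpM2l; first by rewrite !mulr_ge0// ltW.
  have := @cauchy_schwarz_sum R 'I_n xpredT (fun _ => 1) (fun i => Num.sqrt (energy v i))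
    (fun _ _ => ler01) (fun i _ => sqrtr_ge0 _).
  under eq_bigr do rewrite mul1r.
  under [X in Num.sqrt X * _]eq_bigr do rewrite expr1n.
  rewrite sumr_const card_ord => /le_trans; apply.
  apply: ler_wpM2l; first exact: sqrtr_ge0.
  under eq_bigr => i _.
    rewrite sqr_sqrtr; first over.
    by apply: gall_ge0 => z; rewrite mulr_ge0 ?sqr_ge0// ltW.
  by rewrite sum_energy// sqrtr_sqr ger0_norm// sqrtr_ge0.
have := @AGM_root R 'I_n xpredT a; rewrite card_ord (ltnW n1) => /(_ isT (fun i _ => a0 i)) G.
have -> : \prod_(i < n) a i `^ m^-1 = (\prod_(i < n) a i `^ n%:R^-1) `^ (n%:R / m).
  rewrite powR_prod => [|i _]; last exact: powR_ge0.
  by apply: eq_bigr => i _; rewrite -powRrM mulrA mulVf ?mul1r// gt_eqF.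
apply: powR_le; first by rewrite divr_ge0// ltW.
  by apply: prodr_ge0 => i _; exact: powR_ge0.
by apply: le_trans G _; rewrite mulr_suml.
Qed.

Lemma Dnorm_ge0 v : 0 <= Dnorm h k l v.
Proof. exact: sqrtr_ge0. Qed.

(** The choice [t = 2 * (N - 1) / (N - 2)] makes both exponents in [sobolev_power] equal to [r], so
    the same sum [S] stands on both sides and [Num.sqrt S] can be cancelled. *)
Lemma sobolev_ge3 v : (3 <= n)%N -> interior_supp v ->
  powsum (2 * n%:R / (n%:R - 2)) v `^ (2 * n%:R / (n%:R - 2))^-1 <=
  CS R n * Dnorm h k l v.
Proof.
move=> n3 v0; have m1 : n.-1%:R = n%:R - 1 :> R.
  by rewrite -[n in RHS](prednK (ltnW n1)) -addn1 natrD addrK.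
have N3 : 3 <= n%:R :> R by rewrite ler_nat.
set N := n%:R in m1 N3 *; pose t := 2 * (N - 1) / (N - 2).
have t1 : 1 < t by rewrite /t ltr_pdivlMr; lra.
set r := 2 * N / (N - 2).
have r0 : 0 < r by rewrite divr_gt0//; lra.
have := sobolev_power t1 v0; rewrite -/N m1.
have -> : t * (N / (N - 1)) = r by rewrite /t /r; field; apply/andP; split; lra.
have -> : 2 * (t - 1) = r by rewrite /t /r; field; lra.
have -> : 2 * t / Num.sqrt N = CS R n.
  have sN : Num.sqrt N != 0 by rewrite gt_eqF// sqrtr_gt0; lra.
  by rewrite /CS n3 -/N /t; field; rewrite sN /=; lra.
have CS0 : 0 <= CS R n.
  by rewrite /CS n3 -/N divr_ge0 ?mulr_ge0 ?sqrtr_ge0//; lra.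
have D0 := Dnorm_ge0 v.
set D := Dnorm h k l v in D0 *; set C := CS R n in CS0 *.
have := powsum_ge0 (k := k) (l := l) h0 r v; set S := powsum r v => S0 HS.
have [->|Sn0] := eqVneq S 0.
  by rewrite powR0 ?mulr_ge0// invr_eq0 gt_eqF.
have Sp : 0 < S by rewrite lt_neqAle eq_sym Sn0.
have e0 : 0 < N / (N - 1) by rewrite divr_gt0//; lra.
have {}HS : S `^ ((N - 1) / N) <= C * Num.sqrt S * D.
  have e1 : 0 <= (N - 1) / N by rewrite divr_ge0//; lra.
  apply: le_trans (powR_le e1 S0 HS) _; rewrite -powRrM.
  have -> : N / (N - 1) * ((N - 1) / N) = 1 by field; apply/andP; split; lra.
  by rewrite powRr1// !mulr_ge0 ?sqrtr_ge0.
have E : S `^ ((N - 1) / N) = S `^ r^-1 * Num.sqrt S.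
  rewrite -powR12_sqrt// -powRDp; last by rewrite addr_gt0// invr_gt0.
  by congr (_ `^ _); rewrite /r; field; apply/andP; split; lra.
by move: HS; rewrite E mulrAC ler_pM2r// sqrtr_gt0.
Qed.

(** The argument in dimension 2 yields a constant free of [CS R 2]; this bound passes from it to the
    stated one. *)
Lemma CS2_ge1 : 1 <= CS R 2.
Proof.
rewrite /CS /=; have := expR_gt0 (1 : R) => e0; have := @pi_ge2 R => p2.
have : 1 <= Num.sqrt (2 * pi * (expR 1 + 256)) :> R.
  rewrite -[leLHS]sqrtr1 ler_wsqrtr//; nra.
lra.
Qed.

Lemma powsum_eq0 (r r' : R) v : 0 < r' -> powsum r v <= 0 -> powsum r' v = 0.
Proof.
move=> r0 S0; have H0 := hvol_gt0 h0.
have : powsum r v == 0 by rewrite eq_le S0 powsum_ge0.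
rewrite psumr_eq0 => [/allP E|p _]; last by rewrite mulr_ge0 ?powR_ge0 ?ltW.
apply: big1 => p _; have := E p (mem_index_enum p).
rewrite /= mulf_eq0 (gt_eqF H0) orbF => /eqP/powR_eq0_eq0 ->.
by rewrite powR0 ?mul0r// gt_eqF.
Qed.

Lemma W0_interior_supp v : interior_supp v -> W0 k l v.
Proof. by move=> v0 z /andP[_ /v0]. Qed.

Lemma poincare_powsum (CP : R) v : poincare_const h k l CP -> interior_supp v ->
  powsum 2 v <= (CP * Dnorm h k l v) ^+ 2.
Proof.
move=> HP v0; have := HP v (W0_interior_supp v0).
rewrite Lrnorm_powsum// powR12_sqrt ?powsum_ge0// => HS.
rewrite -[leLHS]sqr_sqrtr ?powsum_ge0//.
by rewrite ler_pXn2r// ?nnegrE ?sqrtr_ge0// (le_trans (sqrtr_ge0 _) HS).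
Qed.

(** The test function is the indicator of the interior, which contains the point with coordinates
    [k i + 1]. Its norm is positive, while a negative [CP] makes the right side nonpositive. *)
Lemma poincare_ge0 (CP : R) : poincare_const h k l CP -> 0 <= CP.
Proof.
move=> HP; rewrite leNgt; apply/negP => CP0; have H0 := hvol_gt0 h0.
pose v z : R := (inint k l z)%:R.
have v0 : interior_supp v by move=> z /negPf vz; rewrite /v vz.
have := HP v (W0_interior_supp v0); rewrite Lrnorm_powsum//.
have g1 i : (1 < gsize k l)%N.
  rewrite ltnS; apply: leq_trans (leq_bigmax i).
  by rewrite -lez_nat absz_side// lerBrDl ltW.
pose p : {ffun 'I_n -> 'I_(gsize k l)} := [ffun i => Ordinal (g1 i)].
have vp : v (gpt p) = 1.
  rewrite /v; suff -> : inint k l (gpt p) by [].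
  by apply/forallP => i; rewrite /gpt ffunE /= kl ltrDl.
have S0 : 0 < powsum 2 v.
  apply: lt_le_trans H0 _; rewrite [leRHS](bigD1 p)//= vp normr1 powR1 mul1r.
  rewrite lerDl; apply: sumr_ge0 => q _; apply: mulr_ge0; [exact: powR_ge0|exact: ltW (hvol_gt0 h0)]. 
apply/negP; rewrite -ltNge; apply: le_lt_trans (powR_gt0 _ S0).
by rewrite nmulr_rle0// Dnorm_ge0.
Qed.

(* Young's inequality splits [`|v| `^ (2 * t)] between the exponents [2] and [2 * (t + 1)]; the
   weights are chosen so that the hypothesis lets the second part be absorbed. *)
Lemma powsum_interpolation (c : R) t v : 0 < c -> 1 < t ->
  powsum (2 * (t + 1)) v <= c * powsum (2 * t) v ->
  powsum (2 * t) v <= c `^ (t - 1) * powsum 2 v.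
Proof.
move=> c0 t1 Hc.
have Y : powsum (2 * t) v <= t^-1 * (c `^ (t - 1) * powsum 2 v) +
    (1 - t^-1) * (c^-1 * powsum (2 * (t + 1)) v).
  rewrite !mulr_sumr -big_split/=; apply: ler_sum => p _.
  set a := `|v _|; have a0 : 0 <= a by exact: normr_ge0.
  have ti1 : t^-1 < 1 by rewrite invf_lt1//; lra.
  (* With these weights the powers of [c] cancel, and those of [a] add up to [2 * t] because
     [1 + (t + 1) * (t - 1) = t ^+ 2]. *)
  have := @young R t^-1 (c `^ (t - 1) * a `^ 2) (c^-1 * a `^ (2 * (t + 1))).
  rewrite invr_gt0 ti1 !mulr_ge0 ?invr_ge0 ?powR_ge0 ?(ltW c0)//.
  have tp : 0 < t by lra.
  rewrite tp => /(_ isT isT isT isT).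
  rewrite !powRM ?invr_ge0 ?powR_ge0 ?(ltW c0)// powRV ?(ltW c0)// -!powRrM.
  have -> : (t - 1) / t = 1 - t^-1 by field; lra.
  have -> : c `^ (1 - t^-1) * a `^ (2 / t) *
     ((c `^ (1 - t^-1))^-1 * a `^ (2 * (t + 1) * (1 - t^-1))) = a `^ (2 * t).
    rewrite mulrACA divff ?gt_eqF ?powR_gt0// mul1r -powRDp.
      by congr (_ `^ _); field; lra.
    rewrite addr_gt0// ?divr_gt0// !mulr_gt0//; lra.
  move=> /(ler_wpM2r (ltW (hvol_gt0 h0)))/le_trans; apply.
  by rewrite le_eqVlt; apply/orP; left; apply/eqP; ring.
have : c^-1 * powsum (2 * (t + 1)) v <= powsum (2 * t) v.
  by rewrite ler_pdivrMl.
have ti0 : 0 < t^-1 by rewrite invr_gt0; lra.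
have ti1 : t^-1 < 1 by rewrite invf_lt1//; lra.
move: Y; set A := c^-1 * _; set B := c `^ _ * _; set S := powsum _ _.
move=> Y AS; rewrite -subr_ge0 -(pmulr_rge0 _ ti0).
have : (1 - t^-1) * A <= (1 - t^-1) * S by rewrite ler_wpM2l// subr_ge0 ltW.
move: Y; set s := t^-1; nra.
Qed.

(** For [n = 2], [sobolev_power] at [t + 1] bounds the sum with exponent [2 * (t + 1)] by [c] times
    the one with exponent [2 * t]. Interpolation then descends to exponent 2, where the Poincare
    inequality applies. *)
Lemma sobolev_2 (CP : R) t v : n = 2%N -> poincare_const h k l CP -> 1 < t ->
  interior_supp v ->
  powsum (2 * t) v `^ (2 * t)^-1 <= 4 * t * CS R 2 * (1 + CP) * Dnorm h k l v.
Proof.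
move=> n2 HP t1 v0; have CP0 := poincare_ge0 HP; have D0 := Dnorm_ge0 v.
have P2 := poincare_powsum HP v0.
have t0 : 0 < 2 * t by lra.
have C1 := CS2_ge1.
set D := Dnorm h k l v in D0 P2 *.
(* Interpolation needs [c] positive, so [D = 0] is treated apart; there the Poincare inequality
   makes the sums vanish. *)
have [D00|Dn0] := eqVneq D 0.
  rewrite (powsum_eq0 (r := 2))//; last by rewrite (le_trans P2)// D00 mulr0 expr0n.
  by rewrite powR0 ?D00 ?mulr0// invr_eq0 gt_eqF.
have Dp : 0 < D by rewrite lt_neqAle eq_sym Dn0.
have S0 := powsum_ge0 (k := k) (l := l) h0 (2 * t) v.
pose c := (2 * (t + 1) * D) ^+ 2.
have B0 : 0 < 2 * (t + 1) * D by rewrite !mulr_gt0//; lra.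
have c0 : 0 < c by rewrite exprn_gt0.
have Hc : powsum (2 * (t + 1)) v <= c * powsum (2 * t) v.
  have t2 : 1 < t + 1 by lra.
  have := sobolev_power t2 v0; rewrite -/D.
  have -> : n%:R / n.-1%:R = 2%:R :> R by rewrite n2 divr1.
  have -> : n%:R = 2 :> R by rewrite n2.
  rewrite (mulrC (t + 1)); have -> : 2 * (t + 1 - 1) = 2 * t by ring.
  rewrite powR_mulrn; last first.
    by rewrite !mulr_ge0 ?invr_ge0 ?sqrtr_ge0//; lra.
  rewrite !exprMn exprVn (sqr_sqrtr S0) (sqr_sqrtr (ler0n R 2)).
  move=> /le_trans; apply.
  rewrite /c !exprMn; set S := powsum _ _ in S0 *.
  have X0 : 0 <= 2 * ((t + 1) ^+ 2 * (S * D ^+ 2)).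
    exact: mulr_ge0 (ler0n _ 2) (mulr_ge0 (sqr_ge0 _) (mulr_ge0 S0 (sqr_ge0 _))).
  rewrite -subr_ge0 (le_trans X0)// le_eqVlt; apply/orP; left; apply/eqP.
  by field.
have Y := powsum_interpolation c0 t1 Hc.
(* [E] dominates both [2 * (t + 1) * D], the root of [c], and [CP * D], so the product of their
   powers is at most [E^(2 * t)]. *)
pose E := 2 * (t + 1) * (1 + CP) * D.
have E0 : 0 <= E by rewrite !mulr_ge0//; lra.
apply: (@le_trans _ _ E); last first.
  rewrite /E; apply: ler_wpM2r => //; apply: ler_wpM2r; first by lra.
  nra.
rewrite -[leRHS](@powRK R (2 * t))// ?gt_eqF//; apply: powR_le => //.
  by rewrite invr_ge0 ltW.
apply: (le_trans Y); have -> : 2 * t = 2 * (t - 1) + 2 by ring.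
rewrite [leRHS]powRDp; last by lra.
have B1 : 2 * (t + 1) * D <= E.
  rewrite /E; apply: ler_wpM2r => //; nra.
have B2 : CP * D <= E by rewrite /E; apply: ler_wpM2r => //; nra.
apply: ler_pM; rewrite ?powR_ge0 ?powsum_ge0//.
  rewrite /c -powR_mulrn ?(ltW B0)// -powRrM; apply: powR_le => //.
  - by lra.
  - exact: ltW.
apply: (le_trans P2); rewrite powR_mulrn//.
by rewrite ler_pXn2r// nnegrE mulr_ge0.
Qed.

End Sobolev.

(** * A series bound and a limit argument for the iteration *)

Section Iteration.
Context {R : realType}.
Implicit Types (x y c s : R).

(** The bound is the value of the infinite series; multiplication by [(1 - x) ^+ 2] gives a closed
    form, proved by induction. *)
Lemma sum_arith_geom x m : 0 <= x -> x < 1 ->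
  \sum_(j < m) (1 + j%:R) * x ^+ j <= ((1 - x)^-1) ^+ 2.
Proof.
move=> x0 x1; have x1' : 0 < 1 - x by rewrite subr_gt0.
rewrite exprVn -[leRHS]div1r ler_pdivlMr ?exprn_gt0//.
suff -> : (\sum_(j < m) (1 + j%:R) * x ^+ j) * (1 - x) ^+ 2 =
    1 - (1 + m%:R * (1 - x)) * x ^+ m.
  rewrite gerBl mulr_ge0 ?exprn_ge0// addr_ge0// mulr_ge0 ?ler0n//; exact: ltW.
elim: m => [|m IH]; first by rewrite big_ord0; ring.
by rewrite big_ord_recr/= mulrDl IH [x ^+ m.+1]exprS -(natr1 m); ring.
Qed.

(** The power of [c] tends to 1. Without limits: [c^e >= 1 + e * ln c] and
    [chi ^+ m >= 1 + m * (chi - 1)], so [y < x] would bound [m * (x - y) * s * (chi - 1)] by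
    [- x * ln c] for every [m]. *)
Lemma le_of_powR_roots x y c s (chi : R) : 0 < c -> 0 < s -> 1 < chi -> 0 <= y ->
  (forall m : nat, x * c `^ (s * chi ^+ m)^-1 <= y) -> x <= y.
Proof.
move=> c0 s0 chi1 y0 Hm; rewrite leNgt; apply/negP => xy.
have x0 : 0 < x by exact: le_lt_trans xy.
have pow_ge m : 1 + m%:R * (chi - 1) <= chi ^+ m.
  elim: m => [|m IH]; first by rewrite mul0r addr0.
  apply: (@le_trans _ _ (chi * (1 + m%:R * (chi - 1)))).
    rewrite -natr1; have : 0 <= m%:R * (chi - 1) ^+ 2 by rewrite mulr_ge0 ?sqr_ge0.
    by rewrite expr2; lra.
  by rewrite exprS; apply: ler_wpM2l => //; lra.
have bound m : (x - y) * (s * (m%:R * (chi - 1))) <= x * - ln c.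
  have p0 : 0 < s * chi ^+ m by rewrite mulr_gt0// exprn_gt0//; lra.
  apply: (@le_trans _ _ ((x - y) * (s * chi ^+ m))).
    apply: ler_wpM2l; first by rewrite subr_ge0 ltW.
    by apply: ler_wpM2l; [exact: ltW|apply: le_trans (pow_ge m); lra].
  rewrite -ler_pdivlMr//; have := Hm m.
  rewrite /powR gt_eqF// => /(le_trans (ler_wpM2l (ltW x0) (expR_ge1Dx _))).
  by set e := _^-1; lra.
pose d := (x - y) * (s * (chi - 1)).
have d0 : 0 < d by rewrite !mulr_gt0// subr_gt0.
have := bound (Num.truncn (x * - ln c / d)).+1.
have := truncnS_gt (x * - ln c / d); set m := _.+1.
rewrite ltr_pdivrMr// /d; set e := x * - ln c; set M := m%:R.
by move=> H1 H2; lra.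
Qed.

End Iteration.

(** * Energy estimates and the Moser iteration *)

Section Moser.
Context {R : realType} {n : nat} {h : 'I_n -> R} {k l : 'I_n -> int}.
Hypotheses (h0 : forall i, 0 < h i) (kl : forall i, k i + 1 < l i).
Local Notation point := ('I_n -> int).
Local Notation H := (hvol h).
Local Notation gall := (@gall R n k l).
Local Notation powsum := (@powsum R n h k l).
Local Notation interior_supp := (@interior_supp R n k l).
Local Notation lnorm s v := (powsum s v `^ s^-1).
Implicit Types (f v w : point -> R) (z : point) (i : 'I_n) (c r s : R).

Lemma gall_sum (I : finType) (F : I -> point -> R) :
  gall (fun z => \sum_j F j z) = \sum_j gall (F j).
Proof. exact: exchange_big. Qed.

Lemma gallZ c f : gall (fun z => c * f z) = c * gall f.
Proof. by rewrite mulr_sumr. Qed.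

(* Testing with [sg v * `|v| `^ (2 * c - 1)]. *)
Lemma energy_ineq v c : 1 <= c -> interior_supp v ->
  Dnorm h k l (fun z => `|v z| `^ c) ^+ 2 <=
  c ^+ 2 * gall (fun z => Num.sg (v z) * `|v z| `^ (2 * c - 1) * - dlap h v z * H).
Proof.
move=> c1 v0; have H0 := hvol_gt0 h0.
have w0 : interior_supp (fun z => `|v z| `^ c).
  by move=> z vz; rewrite v0// normr0 powR0// gt_eqF//; lra.
pose f z := Num.sg (v z) * `|v z| `^ (2 * c - 1).
have f0 : interior_supp f by move=> z vz; rewrite /f v0// sgr0 mul0r.
rewrite -(sum_energy h0)// -/(f _).
have -> : gall (fun z => f z * - dlap h v z * H) =
    \sum_i (H / h i ^+ 2) *
      gall (fun z => (v (shift z i 1) - v z) * (f (shift z i 1) - f z)).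
  under eq_bigr => i _ do rewrite -gall_by_parts// -gallZ.
  rewrite -gall_sum; apply: eq_bigr => p _.
  rewrite /dlap -sumrN mulr_sumr mulr_suml; apply: eq_bigr => i _.
  by field; rewrite gt_eqF.
rewrite mulr_sumr; apply: ler_sum => i _.
rewrite -!gallZ; apply: ler_sum => p _; set z := gpt p.
have -> : Dplus h (fun z => `|v z| `^ c) i z ^+ 2 * H =
    (`|v (shift z i 1)| `^ c - `|v z| `^ c) ^+ 2 * (H / h i ^+ 2).
  by rewrite /Dplus; field; rewrite gt_eqF.
rewrite [leRHS]mulrCA [leLHS]mulrC; apply: ler_wpM2l; last exact: stroock_varopoulos_signed.
by rewrite divr_ge0 ?sqr_ge0// ltW.
Qed.

Definition interior_vol : R := gall (fun z => if inint k l z then H else 0).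

Lemma interior_vol_ge0 : 0 <= interior_vol.
Proof.
by apply: sumr_ge0 => p _; case: ifP => // _; exact: ltW (hvol_gt0 h0).
Qed.

(** Each side is written as a count of the indices [s < L i]; the expanded product counts every
    interior point. *)
Lemma interior_vol_le : interior_vol <= boxvol h k l.
Proof.
have H0 := hvol_gt0 h0.
pose L i := `|l i - k i|%N.
have Lg i : (L i <= gsize k l)%N by exact: ltnW (ltn_gsize i).
have -> : boxvol h k l = \prod_i ((\sum_(s < gsize k l) (s < L i)%N%:R) * h i).
  apply: eq_bigr => i _; congr (_ * _).
  rewrite -(absz_side kl) -/(L i) -natr_sum.
  rewrite -(big_mkcond (fun s : 'I__ => (s < L i)%N) (fun _ => 1%N)) /=.
  by rewrite -(big_ord_widen _ (fun _ => 1%N) (Lg i)) sum_nat_const card_ord muln1.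
rewrite big_split/= -/H bigA_distr_bigA/= mulr_suml; apply: ler_sum => p _.
case: ifPn => [/forallP Hp|_]; last first.
  by rewrite mulr_ge0 ?(ltW H0)// prodr_ge0.
rewrite big1 ?mul1r// => i _; have := Hp i => /andP[_].
rewrite /gpt -lterBDl -(absz_side kl) ltz_nat => ->//.
Qed.

Section Equation.
(** The real [N] acts as the dimension: it will be [n] for [n >= 3] and [nhat] for [n = 2], so one
    iteration serves both cases. *)
Variables (a b v : point -> R) (N q Cs B : R).
Hypotheses (N2 : 2 < N) (qN : N / 2 < q) (Cs0 : 0 <= Cs).
Hypothesis sobolev : forall w, interior_supp w ->
  lnorm (2 * N / (N - 2)) w <= Cs * Dnorm h k l w.
Hypotheses (v0 : interior_supp v)
  (eqn : forall z, inint k l z -> - dlap h v z = a z * v z + b z).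
Hypotheses (B0 : 0 <= B)
  (bB : forall p : {ffun 'I_n -> 'I_(gsize k l)}, inint k l (gpt p) -> `|b (gpt p)| <= B).
Let q' := conjexp q.
Let Lq := Lrnorm h k l q (inint k l) (fun z => `|a z| + 1).
(* Dominates [B * interior_vol `^ e] for every exponent [0 <= e <= 1]. *)
Let T := B * (1 + boxvol h k l).
(** Gain of one step: the quotient of the Sobolev exponent [2 * N / (N - 2)] by [2 * q']. It exceeds
    1 because [N / 2 < q]. *)
Let chi := N / ((N - 2) * q').

Let q1 : 1 < q.
Proof. by move: N2 qN; lra. Qed.

Let q'1 : 1 < q'.
Proof. by have := q1; rewrite /q' /conjexp => Q; rewrite ltr_pdivlMr; lra. Qed.

Let qq' : q^-1 + q'^-1 = 1.
Proof. by have := q1 => Q; rewrite /q' /conjexp; field; apply/andP; split; lra. Qed.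

Lemma inint_inbar z : inint k l z -> inbar k l z.
Proof. by move=> /forallP Hz; apply/forallP => i; have /andP[/ltW -> /ltW ->] := Hz i. Qed.

Let Lq0 : 0 <= Lq.
Proof. exact: powR_ge0. Qed.

(** The cell volume is split between the two factors, with exponents [q^-1] and [q'^-1]. *)
Lemma weighted_hoelder f : (forall z, 0 <= f z) ->
  gall (fun z => if inint k l z then (`|a z| + 1) * f z * H else 0) <=
  Lq * gall (fun z => if inint k l z then f z `^ q' * H else 0) `^ q'^-1.
Proof.
move=> f0; have H0 := hvol_gt0 h0; have q0 : 0 < q by exact: lt_trans q1.
have q'0 : 0 < q' by exact: lt_trans q'1.
pose A z := `|a z| + 1.
have A0 z : 0 <= A z by rewrite addr_ge0.
rewrite -[leLHS]big_mkcond/= -[X in X `^ q'^-1]big_mkcond/=.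
have -> : Lq = (\sum_(p : {ffun 'I_n -> 'I_(gsize k l)} | inint k l (gpt p)) (A (gpt p) * H `^ q^-1) `^ q) `^ q^-1.
  congr (_ `^ _); rewrite /gsum; apply: eq_big => [p|p _].
    by case: (boolP (inint _ _ _)) => [/inint_inbar ->|]; rewrite ?andbF.
  by rewrite powRM ?powR_ge0// powRVK ?gt_eqF ?(ltW H0)// (ger0_norm (A0 _)).
have -> : \sum_(p : {ffun 'I_n -> 'I_(gsize k l)} | inint k l (gpt p)) f (gpt p) `^ q' * H =
    \sum_(p : {ffun 'I_n -> 'I_(gsize k l)} | inint k l (gpt p)) (f (gpt p) * H `^ q'^-1) `^ q'.
  by apply: eq_bigr => p _; rewrite powRM ?powR_ge0// powRVK ?gt_eqF ?(ltW H0).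
apply: le_trans (hoelder_sum q0 q'0 qq' _ _) => [|p _|p _]; last 2 first.
- by rewrite mulr_ge0 ?powR_ge0.
- by rewrite mulr_ge0 ?powR_ge0.
apply: ler_sum => p _; rewrite mulrACA -powRDp ?qq'// ?powRr1 ?(ltW H0)//.
Qed.

Lemma pointwise_rhs c z : 1 <= c -> inint k l z -> `|b z| <= B ->
  Num.sg (v z) * `|v z| `^ (2 * c - 1) * - dlap h v z <=
  (`|a z| + 1) * (`|v z| `^ (2 * c) + B `^ (2 * c)).
Proof.
move=> c1 zi bz; rewrite eqn//; set t := `|v z|.
have t0 : 0 <= t by exact: normr_ge0.
have E (y : R) : 0 <= y -> y * y `^ (2 * c - 1) = y `^ (2 * c).
  by move=> y0; rewrite mulr_powRB1//; lra.
have H1 : Num.sg (v z) * t `^ (2 * c - 1) * (a z * v z + b z) <=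
    `|a z| * t `^ (2 * c) + B * t `^ (2 * c - 1).
  rewrite mulrDr lerD//.
    have -> : Num.sg (v z) * t `^ (2 * c - 1) * (a z * v z) = a z * t `^ (2 * c).
      rewrite -E// /t [X in a z * (X * _)]normrEsg; ring.
    by rewrite ler_wpM2r ?powR_ge0// ler_norm.
  rewrite mulrC mulrA ler_wpM2r ?powR_ge0//.
  apply: le_trans (ler_norm _) _; rewrite normrM normr_sg.
  by case: (v z == 0); rewrite ?mulr1 // mulr0.
apply: (le_trans H1).
(* The larger of [t] and [B] replaces the other. This term accounts for the 1 in [|a z| + 1]. *)
have H2 : B * t `^ (2 * c - 1) <= t `^ (2 * c) + B `^ (2 * c).
  have c2 : 0 <= 2 * c - 1 by lra.
  have [tB|/ltW Bt] := leP t B.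
    apply: (@le_trans _ _ (B * B `^ (2 * c - 1))); first by rewrite ler_wpM2l// powR_le.
    by rewrite E// lerDr powR_ge0.
  apply: (@le_trans _ _ (t * t `^ (2 * c - 1))); first by rewrite ler_wpM2r// powR_ge0.
  by rewrite E// lerDl powR_ge0.
have := mulr_ge0 (normr_ge0 (a z)) (powR_ge0 B (2 * c)).
move: H2; set X := t `^ _; set Y := B `^ _; lra.
Qed.

(** Hoelder's inequality is used twice: on [|v|^(2 * c)], giving [powsum], and on the constant
    [B^(2 * c)], giving [interior_vol]. *)
Lemma energy_bound c : 1 <= c ->
  Dnorm h k l (fun z => `|v z| `^ c) ^+ 2 <=
  c ^+ 2 * (Lq * (powsum (2 * q' * c) v `^ q'^-1 + B `^ (2 * c) * interior_vol `^ q'^-1)).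
Proof.
move=> c1; have H0 := hvol_gt0 h0; have q'0 : 0 < q' by exact: lt_trans q'1.
apply: le_trans (energy_ineq c1 v0) _; apply: ler_wpM2l; first exact: sqr_ge0.
apply: (@le_trans _ _
  (gall (fun z => if inint k l z then (`|a z| + 1) * `|v z| `^ (2 * c) * H else 0) +
   gall (fun z => if inint k l z then (`|a z| + 1) * B `^ (2 * c) * H else 0))).
  rewrite -big_split; apply: ler_sum => p _ /=; case: ifPn => zi; last first.
    by rewrite v0// sgr0 !mul0r addr0.
  rewrite -mulrDl -mulrDr; apply: ler_wpM2r; first exact: ltW.
  by apply: pointwise_rhs => //; exact: bB.
rewrite mulrDr; apply: lerD.
  apply: le_trans (weighted_hoelder (fun z => powR_ge0 _ _)) _.
  rewrite le_eqVlt; apply/orP; left; apply/eqP; congr (_ * (_ `^ _)).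
  apply: eq_bigr => p _; case: ifPn => zi.
    by rewrite -powRrM; congr (_ `^ _ * _); ring.
  have cq : 0 < 2 * q' * c.
    exact: mulr_gt0 (mulr_gt0 (ltr0Sn _ _) q'0) (lt_le_trans ltr01 c1).
  by rewrite v0// normr0 powR0 ?mul0r// gt_eqF.
apply: le_trans (weighted_hoelder (fun z => powR_ge0 _ _)) _.
rewrite le_eqVlt; apply/orP; left; apply/eqP; congr (_ * _).
rewrite -[B `^ (2 * c) in RHS](@powRK R q') ?powR_ge0 ?gt_eqF// -powRM ?powR_ge0 ?interior_vol_ge0//.
congr (_ `^ _); rewrite -gallZ; apply: eq_bigr => p _.
by case: ifP; rewrite ?mulr0.
Qed.

Let q0 : 0 < q. Proof. exact: lt_trans q1. Qed.
Let q'0 : 0 < q'. Proof. exact: lt_trans q'1. Qed.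
Let N20 : 0 < N - 2. Proof. by rewrite subr_gt0. Qed.
Let N0 : 0 < N. Proof. by move: N2; lra. Qed.
Let qN0 : 0 < 2 * q - N. Proof. by move: qN; lra. Qed.

Let T0 : 0 <= T.
Proof.
by rewrite mulr_ge0// addr_ge0// (le_trans interior_vol_ge0)// interior_vol_le.
Qed.

Let chiE : chi = N * (q - 1) / ((N - 2) * q).
Proof.
rewrite /chi /q' /conjexp; field.
by move: q1 q0 N20 => *; rewrite !gt_eqF//= subr_gt0.
Qed.

Let chi1 : 1 < chi.
Proof.
by rewrite chiE ltr_pdivlMr ?mulr_gt0// mul1r; move: qN; lra.
Qed.

Let chi0 : 0 < chi. Proof. exact: lt_trans chi1. Qed.

Lemma interior_vol_powR (e : R) : 0 <= e -> e <= 1 ->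
  interior_vol `^ e <= 1 + boxvol h k l.
Proof.
move=> e0 e1; have V0 := interior_vol_ge0; have V1 := interior_vol_le.
have [V|/ltW V] := leP interior_vol 1.
  apply: (@le_trans _ _ 1); last by rewrite lerDl (le_trans V0).
  by have := powR_le e0 V0 V; rewrite powR1.
apply: le_trans (ler1_powR V e1) _; apply: le_trans V1 _.
by rewrite lerDr.
Qed.

(** The [Num.sqrt 2] comes from the two terms of [energy_bound], which [moser_step] bounds by the
    same quantity. *)
Let C0 : R := Cs * Num.sqrt 2 * Lq `^ 2^-1.

Let C00 : 0 <= C0.
Proof. by rewrite !mulr_ge0 ?sqrtr_ge0 ?powR_ge0. Qed.

(** As [Y] dominates both the norm and [T], each term of [energy_bound] is at most [Y^(2 * c)]. The
    Sobolev inequality for [|v|^c] and a [c]-th root finish. *)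
Lemma moser_step c (Y : R) : 1 <= c -> lnorm (2 * q' * c) v <= Y -> T <= Y ->
  lnorm (2 * N / (N - 2) * c) v <= (C0 * c) `^ c^-1 * Y.
Proof.
move=> c1 XY TY; have c0 : 0 < c by exact: lt_le_trans c1.
have Y0 : 0 <= Y by exact: le_trans TY.
have q'c : 0 < 2 * q' * c by rewrite mulr_gt0// mulr_gt0.
set r := 2 * N / (N - 2).
have r0 : 0 < r by rewrite divr_gt0// mulr_gt0.
set S := powsum (r * c) v; have S0 : 0 <= S by exact: powsum_ge0.
have w0 : interior_supp (fun z => `|v z| `^ c).
  by move=> z vz; rewrite v0// normr0 powR0// gt_eqF.
have := sobolev w0; rewrite -/r.
have -> : powsum r (fun z => `|v z| `^ c) = S.
  apply: eq_bigr => p _.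
  by rewrite (ger0_norm (powR_ge0 _ _)) -powRrM mulrC [c * r]mulrC mulrC.
have c2 : 0 < 2 * c by rewrite mulr_gt0.
have X2 : powsum (2 * q' * c) v `^ q'^-1 <= Y `^ (2 * c).
  apply: le_trans (powR_le (ltW c2) (powR_ge0 _ _) XY).
  rewrite -powRrM le_eqVlt; apply/orP; left; apply/eqP; congr (_ `^ _).
  by field; rewrite !gt_eqF.
have B2 : B `^ (2 * c) * interior_vol `^ q'^-1 <= Y `^ (2 * c).
  apply: (@le_trans _ _ (T `^ (2 * c))); last exact: powR_le (ltW c2) T0 TY.
  (* Written as a [2 * c]-th power, the volume joins [B] with an exponent of at most 1, as [T]
     allows. *)
  have -> : interior_vol `^ q'^-1 = (interior_vol `^ (2 * q' * c)^-1) `^ (2 * c).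
    by rewrite -powRrM; congr (_ `^ _); field; rewrite !gt_eqF.
  rewrite -powRM ?powR_ge0//; apply: powR_le; first exact: ltW.
    by rewrite mulr_ge0// powR_ge0.
  apply: ler_wpM2l => //; apply: interior_vol_powR; first by rewrite invr_ge0 ltW.
  rewrite invf_le1//; move: q'1 c1; rewrite -/q'; move: (q') => x; nra.
have D0 : 0 <= Dnorm h k l (fun z => `|v z| `^ c) by exact: sqrtr_ge0.
have := energy_bound c1; set D := Dnorm h k l _ in D0 * => HD HS.
have Yc : Y `^ (2 * c) = (Y `^ c) ^+ 2 by rewrite powR_pow2.
have {HS}HS : S `^ r^-1 <= C0 * c * Y `^ c.
  apply: (le_trans HS).
  have YC0 : 0 <= C0 * c * Y `^ c by rewrite mulr_ge0 ?powR_ge0// mulr_ge0// ltW.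
  have CD0 : 0 <= Cs * D by exact: mulr_ge0.
  rewrite -ler_sqr ?nnegrE//.
  have -> : (C0 * c * Y `^ c) ^+ 2 = Cs ^+ 2 * (c ^+ 2 * (Lq * (2 * (Y `^ c) ^+ 2))).
    have L2 : (Lq `^ 2^-1) ^+ 2 = Lq.
      by rewrite (powR_pow2 _ Lq0) mulfV ?pnatr_eq0// (powRr1 Lq0).
    by rewrite /C0 !exprMn sqr_sqrtr// L2; ring.
  rewrite exprMn; apply: ler_wpM2l; first exact: sqr_ge0.
  apply: (le_trans HD); apply: ler_wpM2l; first exact: sqr_ge0.
  by apply: (ler_wpM2l Lq0); rewrite -Yc [leRHS]mulr_natl mulr2n; exact: lerD X2 B2.
have E : S `^ (r * c)^-1 = (S `^ r^-1) `^ c^-1 by rewrite -powRrM invfM.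
have C0c : 0 <= C0 * c by exact: mulr_ge0 C00 (ltW c0).
have ci0 : 0 <= c^-1 by rewrite invr_ge0 ltW.
rewrite E; apply: le_trans (powR_le ci0 (powR_ge0 S r^-1) HS) _.
by rewrite (powRM _ C0c (powR_ge0 Y c)) powRK// gt_eqF.
Qed.

Let C : R := Num.max chi C0.
Let Y0 : R := Num.max (lnorm (2 * q') v) T.

Let C1 : 1 <= C.
Proof. by rewrite le_max (ltW chi1). Qed.

Let Y00 : 0 <= Y0.
Proof. by rewrite le_max T0 orbT. Qed.

(* [C0 * chi ^+ j <= C `^ (1 + j)], so step [j] costs the exponent [(1 + j) * chi^-1 ^+ j], and these
   exponents sum to the exponent of [K]. *)
Lemma moser_iteration m :
  lnorm (2 * q' * chi ^+ m) v <= C `^ (\sum_(j < m) (1 + j%:R) * chi^-1 ^+ j) * Y0.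
Proof.
elim: m => [|m IH].
  by rewrite expr0 mulr1 big_ord0 powRr0 mul1r le_max lexx.
have cm0 : 0 < chi ^+ m by rewrite exprn_gt0.
have cm1 : 1 <= chi ^+ m by rewrite exprn_ege1// ltW.
have e0 : 0 <= \sum_(j < m) (1 + j%:R) * chi^-1 ^+ j.
  apply: sumr_ge0 => j _; rewrite mulr_ge0 ?addr_ge0//.
  by rewrite exprn_ge0// invr_ge0 ltW.
have TY : T <= C `^ (\sum_(j < m) (1 + j%:R) * chi^-1 ^+ j) * Y0.
  apply: (@le_trans _ _ Y0); first by rewrite le_max lexx orbT.
  rewrite ler_peMl//; have := ler_powR C1 e0; by rewrite powRr0.
have := moser_step cm1 IH TY.
(* By the choice of [chi], the exponent gained at stage [m] is the starting exponent of stage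
   [m.+1]. *)
have -> : 2 * N / (N - 2) * chi ^+ m = 2 * q' * chi ^+ m.+1.
  by rewrite exprS /chi; field; rewrite !gt_eqF.
move=> /le_trans; apply; rewrite mulrA; apply: ler_wpM2r => //.
have m10 : 0 < 1 + m%:R :> R by rewrite addrC natr1 ltr0Sn.
rewrite big_ord_recr/= addrC powRDp; last first.
  by rewrite ltr_wpDr// mulr_gt0// exprn_gt0// invr_gt0.
apply: ler_wpM2r; first exact: powR_ge0.
have Cp : 0 <= C by exact: le_trans C1.
rewrite exprVn powRrM; apply: powR_le.
- by rewrite invr_ge0 ltW.
- by rewrite mulr_ge0// ltW.
rewrite powRDp// powRr1// powR_mulrn//.
apply: ler_pM => //; first exact: ltW.
  by rewrite le_max lexx orbT.
by rewrite lerXn2r ?nnegrE ?(ltW chi0)// le_max lexx.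
Qed.

Let K : R := C `^ ((N * (q - 1) / (2 * q - N)) ^+ 2).

Let K0 : 0 <= K. Proof. exact: powR_ge0. Qed.

(** A single term of the sum; the surplus factor tends to 1 as [s] grows and is removed by
    [le_of_powR_roots]. *)
Lemma sup_le_lnorm s (p : {ffun 'I_n -> 'I_(gsize k l)}) : 0 < s ->
  `|v (gpt p)| * H `^ s^-1 <= lnorm s v.
Proof.
move=> s0; have H0 := hvol_gt0 h0.
have -> : `|v (gpt p)| * H `^ s^-1 = (`|v (gpt p)| `^ s * H) `^ s^-1.
  by rewrite powRM ?powR_ge0 ?(ltW H0)// powRK// gt_eqF.
apply: powR_le; first by rewrite invr_ge0 ltW.
  by rewrite mulr_ge0 ?powR_ge0// ltW.
rewrite [leRHS](bigD1 p)//= lerDl; apply: sumr_ge0 => p' _.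
by apply: mulr_ge0; [exact: powR_ge0|exact: ltW].
Qed.

(** Passage to the limit in the iteration: the exponents of [C] stay below [(1 - chi^-1)^-1 ^+ 2],
    which is the exponent in [K]. *)
Lemma moser_sup (p : {ffun 'I_n -> 'I_(gsize k l)}) : `|v (gpt p)| <= K * Y0.
Proof.
apply: (@le_of_powR_roots R _ _ H (2 * q') chi) => //.
- exact: hvol_gt0.
- by rewrite mulr_gt0.
- by rewrite mulr_ge0.
move=> m; apply: le_trans (sup_le_lnorm _ _) _.
  by rewrite mulr_gt0 ?exprn_gt0// mulr_gt0.
apply: le_trans (moser_iteration m) _; apply: ler_wpM2r => //.
apply: ler_powR => //.
have -> : N * (q - 1) / (2 * q - N) = (1 - chi^-1)^-1.
  rewrite chiE; field.
  have q10 : 0 < q - 1 by rewrite subr_gt0.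
  have -> : N * (q - 1) - (N - 2) * q = 2 * q - N by ring.
  by rewrite !gt_eqF.
apply: sum_arith_geom; first by rewrite invr_ge0 ltW.
by rewrite invf_lt1.
Qed.

(** From [|v|^(2 * q') <= M^(2 * q' - 2) * |v|^2] the starting norm is at most
    [M^(q^-1) * L^(q'^-1)]; the power of [M] has exponent below 1 and can be absorbed. *)
Lemma moser_L2 (M : R) : 0 <= M ->
  (forall p : {ffun 'I_n -> 'I_(gsize k l)}, `|v (gpt p)| <= M) -> M <= K * Y0 ->
  M <= (2 * K) `^ q' * lnorm 2 v + 2 * K * T.
Proof.
move=> M0 vM MK; set L := lnorm 2 v.
have L0 : 0 <= L by exact: powR_ge0.
have q'n : q' != 0 by rewrite gt_eqF.
have interp : lnorm (2 * q') v <= M `^ q^-1 * L `^ q'^-1.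
  have e0 : 0 < 2 * q' by rewrite mulr_gt0.
  have e2 : 0 < 2 * q' - 2 by move: q'1; lra.
  have P : powsum (2 * q') v <= M `^ (2 * q' - 2) * powsum 2 v.
    rewrite mulr_sumr; apply: ler_sum => p _; rewrite mulrA.
    apply: ler_wpM2r; first exact: ltW (hvol_gt0 h0).
    rewrite -{1}(subrK 2 (2 * q')) powRDp ?subrK//.
    by apply: ler_wpM2r; rewrite ?powR_ge0// powR_le// ltW.
  have ei : 0 <= (2 * q')^-1 by rewrite invr_ge0 ltW.
  apply: le_trans (powR_le ei (powsum_ge0 h0 _ _) P) _.
  have -> : L `^ q'^-1 = powsum 2 v `^ (2 * q')^-1 by rewrite /L -powRrM -invfM.
  rewrite (powRM _ (powR_ge0 M _) (powsum_ge0 h0 _ _)) -powRrM.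
  rewrite le_eqVlt; apply/orP; left; apply/eqP; congr (_ `^ _ * _).
  by rewrite -[q^-1](addrK q'^-1) qq'; field.
have Y0le : Y0 <= M `^ q^-1 * L `^ q'^-1 + T.
  rewrite ge_max; apply/andP; split; first by rewrite (le_trans interp)// lerDl.
  by rewrite lerDr mulr_ge0 ?powR_ge0.
have {}MK : M <= K * (M `^ q^-1 * L `^ q'^-1) + K * T.
  by apply: (le_trans MK); rewrite -mulrDr ler_wpM2l.
have K2 : 0 <= 2 * K by rewrite mulr_ge0.
have s1 : q'^-1 < 1 by rewrite invf_lt1.
have s0 : 0 < q'^-1 by rewrite invr_gt0.
(* Doubling [MK] and applying Young's inequality gives [2 * M <= X + M + 2 * K * T], so one [M]
   cancels; this is where [2 * K] comes from. *)
have := @young R q'^-1 ((2 * K) `^ q' * L) M s0 s1.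
rewrite mulr_ge0 ?powR_ge0// => /(_ isT M0).
rewrite powRM ?powR_ge0// powRK//.
have -> : 1 - q'^-1 = q^-1 by rewrite -qq' addrK.
set X := (2 * K) `^ q' * L; have X0 : 0 <= X by rewrite mulr_ge0 ?powR_ge0.
have X1 : q'^-1 * X <= X by rewrite ler_piMl// ltW.
have M1 : q^-1 * M <= M by rewrite ler_piMl// invf_le1// ltW.
move: MK; set x := M `^ _; set y := L `^ _; move: (K) => K'; lra.
Qed.

End Equation.
End Moser.

(** * Extension by zero and conclusion *)

Section Extension.
Context {R : realType} {n : nat} {h : 'I_n -> R} {k l : 'I_n -> int}.
Implicit Types (u : ('I_n -> int) -> R) (z : 'I_n -> int).

(** The values of [u] off the closed mesh are arbitrary. Setting them to 0 gives a function in
    [interior_supp] that agrees with [u] on the closed mesh whenever [u] is in [W0]. *)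
Definition zext u z : R := if inint k l z then u z else 0.

Lemma zext_supp u : interior_supp (k := k) (l := l) (zext u).
Proof. by move=> z /negPf zi; rewrite /zext zi. Qed.

Lemma zext_inbar u z : W0 k l u -> inbar k l z -> zext u z = u z.
Proof.
by move=> u0 zb; rewrite /zext; case: ifPn => // zi; rewrite u0// /onbd zb.
Qed.

Lemma inbar_shift z i s : inint k l z -> `|s| <= 1 -> inbar k l (shift z i s).
Proof.
move=> /forallP zi; rewrite ler_norml => /andP[s1 s2]; apply/forallP => j.
have /andP[kz zl] := zi j; rewrite /shift; case: eqP => _; last by rewrite !ltW.
by move: kz zl s1 s2; lia.
Qed.

Lemma dlap_zext u z : W0 k l u -> inint k l z -> dlap h (zext u) z = dlap h u z.
Proof.
move=> u0 zi; apply: eq_bigr => i _.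
by rewrite !(zext_inbar u0)// ?inbar_shift ?inint_inbar.
Qed.

Lemma supnorm_zext u : W0 k l u -> supnorm k l (inbar k l) (zext u) = supnorm k l (inbar k l) u.
Proof. by move=> u0; apply: eq_bigr => p /andP[zb _]; rewrite zext_inbar. Qed.

Lemma Lrnorm_zext (r : R) u : W0 k l u ->
  Lrnorm h k l r (inbar k l) (zext u) = Lrnorm h k l r (inbar k l) u.
Proof.
move=> u0; congr (_ `^ _).
by apply: eq_bigr => p /andP[zb _]; rewrite zext_inbar.
Qed.

End Extension.

(** The two cases of the theorem differ only in [N] and in the Sobolev constant [Cs], which are
    parameters here. *)
Lemma sup_bound_of_sobolev (R : realType) (n : nat) (h : 'I_n -> R) (k l : 'I_n -> int)
  (a b u : ('I_n -> int) -> R) (q N Cs : R) :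
  (forall i, 0 < h i) -> (forall i, k i + 1 < l i) ->
  2 < N -> N / 2 < q -> 0 <= Cs ->
  (forall w, interior_supp (k := k) (l := l) w ->
    powsum (h := h) (k := k) (l := l) (2 * N / (N - 2)) w `^ (2 * N / (N - 2))^-1
      <= Cs * Dnorm h k l w) ->
  (forall z, inint k l z -> - dlap h u z = a z * u z + b z) ->
  W0 k l u ->
  let K := Num.max (N / ((N - 2) * conjexp q))
      (Cs * Num.sqrt 2 * Lrnorm h k l q (inint k l) (fun z => `|a z| + 1) `^ 2^-1)
    `^ ((N * (q - 1) / (2 * q - N)) ^+ 2) in
  supnorm k l (inbar k l) u <=
    (2 * K) `^ (conjexp q) * Lrnorm h k l 2 (inbar k l) u
    + 2 * K * supnorm k l (inint k l) b * (1 + boxvol h k l).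
Proof.
move=> h0 kl N2 qN Cs0 sob eqn u0; cbv zeta; set K := Num.max _ _ `^ _.
pose v := zext (k := k) (l := l) u.
have v0 : interior_supp (k := k) (l := l) v by exact: zext_supp.
have eqv z : inint k l z -> - dlap h v z = a z * v z + b z.
  by move=> zi; rewrite dlap_zext// eqn// /v /zext zi.
set B := supnorm k l (inint k l) b.
have B0 : 0 <= B.
  by apply: (big_ind (fun x : R => 0 <= x)) => // x y x0 y0; rewrite le_max x0.
have bB (p : {ffun 'I_n -> 'I_(gsize k l)}) : inint k l (gpt p) -> `|b (gpt p)| <= B.
  by move=> zi; apply: (le_bigmax_cond _ (fun p => `|b (gpt p)|)); rewrite inint_inbar.
rewrite -(supnorm_zext u0) -(Lrnorm_zext 2 u0) Lrnorm_powsum// -mulrA.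
set M := supnorm k l (inbar k l) _.
have M0 : 0 <= M.
  by apply: (big_ind (fun x : R => 0 <= x)) => // x y x0 y0; rewrite le_max x0.
have vM (p : {ffun 'I_n -> 'I_(gsize k l)}) : `|v (gpt p)| <= M.
  have [zb|zb] := boolP (inbar k l (gpt p)).
    by apply: (le_bigmax_cond _ (fun p => `|v (gpt p)|)); rewrite zb.
  by rewrite v0 ?normr0//; apply: contra zb; exact: inint_inbar.
apply: (moser_L2 h0 kl N2 qN B0 M0 vM).
have S p := moser_sup h0 kl N2 qN Cs0 sob v0 eqv B0 bB p.
(* The maximum starts from 0, so the bound must itself be nonnegative; the estimate at any grid
   point shows this. *)
apply: bigmax_le => [|p _]; last exact: S.
by have := S [ffun _ => ord0]; apply: le_trans.
Qed.

Unset Implicit Arguments.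

Theorem mainTheorem13 (R : realType) (n : nat) (h : 'I_n -> R) (k l : 'I_n -> int)
  (a b u : ('I_n -> int) -> R) (q nhat CP : R) :
  (2 <= n)%N ->
  (forall i, 0 < h i) ->
  (forall i, k i + 1 < l i) ->
  n%:R / 2 < q ->
  (n = 2%N -> 1 < nhat / 2 /\ nhat / 2 < q) ->
  poincare_const h k l CP ->
  (forall z, inint k l z -> - dlap h u z = a z * u z + b z) ->
  W0 k l u ->
  let K := Kconst n q nhat CP (Lrnorm h k l q (inint k l) (fun z => `|a z| + 1)) in
  supnorm k l (inbar k l) u <=
    (2 * K) `^ (conjexp q) * Lrnorm h k l 2 (inbar k l) u
    + 2 * K * supnorm k l (inint k l) b * (1 + boxvol h k l).
Proof.
move=> n2 h0 kl qn qhat HP eqn u0; cbv zeta; set K := Kconst _ _ _ _ _.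
have n1 : (1 < n)%N by [].
have [n3|] := leqP 3 n.
  have N3 : 3 <= n%:R :> R by rewrite (ler_nat R 3).
  have -> : K = Num.max (n%:R / ((n%:R - 2) * conjexp q))
      (CS R n * Num.sqrt 2 * Lrnorm h k l q (inint k l) (fun z => `|a z| + 1) `^ 2^-1)
    `^ ((n%:R * (q - 1) / (2 * q - n%:R)) ^+ 2) by rewrite /K /Kconst n3.
  apply: sup_bound_of_sobolev => //.
  - by lra.
  - by rewrite /CS n3 divr_ge0 ?mulr_ge0 ?sqrtr_ge0//; lra.
  - by move=> w; exact: sobolev_ge3.
rewrite ltnS => n2'; have nE : n = 2%N by apply/eqP; rewrite eqn_leq n2' n2.
have [hat1 hat2] := qhat nE; have CP0 := poincare_ge0 h0 kl HP.
have C1 : 1 <= CS R 2 by exact: CS2_ge1.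
have N2 : 2 < nhat by lra.
have -> : K = Num.max (nhat / ((nhat - 2) * conjexp q))
    (4 * nhat / (nhat - 2) * CS R 2 * (1 + CP) * Num.sqrt 2 *
      Lrnorm h k l q (inint k l) (fun z => `|a z| + 1) `^ 2^-1)
  `^ ((nhat * (q - 1) / (2 * q - nhat)) ^+ 2) by rewrite /K /Kconst ltnNge n2'.
(* With this [t], [2 * t] is the Sobolev exponent of dimension [nhat], and [4 * t] is the factor
   [4 * nhat / (nhat - 2)] in [K]. *)
have t1 : 1 < nhat / (nhat - 2) by rewrite ltr_pdivlMr; lra.
apply: sup_bound_of_sobolev => //.
- apply: mulr_ge0; last by rewrite addr_ge0.
  by apply: mulr_ge0; [rewrite divr_ge0//; lra|exact: le_trans C1].
- move=> w w0; have := sobolev_2 h0 kl n1 nE HP t1 w0.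
  by rewrite !mulrA.
Qed.
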